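(* Let $G$ be a generic game. If the correlated equilibrium polytope $P_G$ is not full-dimensional, then there is a proper subgame $\tilde G$ of $G$ (i.e. a game with smaller strategy sets) such that $P_{\tilde G}$ is full-dimensional and $P_G$ is affinely isomorphic to $P_{\tilde G}$.
   Context: **Games.** A game $G=(n,S,X)$ (in normal form) consists of $n\ge 2$ players, finite nonempty sets $S^{(i)}$ of pure strategies for $i\in[n]=\{1,\dots,n\}$, with $S=\prod_{i=1}^n S^{(i)}$, and real payoff tensors $X=(X^{(1)},\dots,X^{(n)})$, where $X^{(i)}_{j_1,\dots,j_n}\in\mathbb{R}$ is the payoff of player $i$ when each player $i'$ plays $j_{i'}\in S^{(i')}$. Write $d_i=|S^{(i)}|$, usually identify $S^{(i)}=[d_i]$, and put $D=\prod_{i=1}^n d_i$. Identify $\mathbb{R}^D=\bigotimes_{i=1}^n\mathbb{R}^{d_i}$ and let $\Delta_{D-1}\subseteq\mathbb{R}^D$ be the probability simplex. **Slices and linear forms.** For $p\in\mathbb{R}^D$, $i\in[n]$, $k\in[d_i]$, let $p_{-i,k}\in\mathbb{R}^{D/d_i}=\bigotimes_{i'\ne i}\mathbb{R}^{d_{i'}}$ be the $k$-th slice of $p$ in the $i$-th direction, i.e. the tensor of entries $p_{j_1,\dots,j_{i-1},k,j_{i+1},\dots,j_n}$. For $k,\ell\in[d_i]$ define the linear form on $\mathbb{R}^{D/d_i}$ $$H^{X^{(i)}}_{k,\ell}(q)=\sum_{j\in\prod_{i'\neq i}[d_{i'}]}\bigl(X^{(i)}_{j_1,\dots,j_{i-1},k,j_{i+1},\dots,j_n}-X^{(i)}_{j_1,\dots,j_{i-1},\ell,j_{i+1},\dots,j_n}\bigr)\,q_j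 .$$ **Correlated equilibria.** $P_G\subseteq\Delta_{D-1}$ is the set of all $p\in\Delta_{D-1}$ satisfying the incentive constraints $H^{X^{(i)}}_{k,\ell}(p_{-i,k})\ge 0$ for all $i\in[n]$ and $k,\ell\in[d_i]$; it is a convex polytope. It is called full-dimensional if its dimension is $D-1$ (the dimension of the simplex of that game). **Subgame.** A subgame of $G$ is a game $\tilde G=(n,\tilde S,\tilde X)$ with $\tilde S=\prod_i\tilde S^{(i)}$, $\emptyset\neq\tilde S^{(i)}\subseteq S^{(i)}$, and $\tilde X^{(i)}$ the restriction of $X^{(i)}$ to $\tilde S$. It is proper if $\tilde S\ne S$. For a subgame, full-dimensional means that $P_{\tilde G}$ has dimension $|\tilde S|-1$. **Genericity.** Let $A_G$ be the matrix with $D$ columns whose rows are the coefficient vectors (in the variable $p\in\mathbb{R}^D$) of all linear forms $p\mapsto H^{X^{(i)}}_{k,\ell}(p_{-i,k})$ ($i\in[n]$, $k\neq\ell\in[d_i]$) and of all coordinate forms $p\mapsto p_{j_1,\dots,j_n}$. Its entries are polynomials in the payoffs. The game $G$ is generic if every $D\times D$ minor of $A_G$ that is not identically zero as a polynomial in the payoffs is nonzero at the payoff tuple $X$ of $G$. Two polytopes are affinely isomorphic if there is an affine bijection between their affine hulls mapping one polytope onto the other. *)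

(* Defs.v *)
From HB Require Import structures.
From mathcomp Require Import all_boot all_order all_algebra.
From mathcomp Require Import mpoly.
From mathcomp Require Import boolp classical_sets functions reals.

Set Implicit Arguments.
Unset Strict Implicit.
Unset Printing Implicit Defensive.

Import Order.TTheory GRing.Theory Num.Theory.

Local Open Scope classical_set_scope.
Local Open Scope ring_scope.

Section Tensors.
Variables (n : nat) (S : 'I_n -> finType).

Definition profile : finType := {dffun forall i : 'I_n, S i}.

Definition others (i : 'I_n) : finType := {i' : 'I_n | i' != i}.

Definition oprofile (i : 'I_n) : finType :=
  {dffun forall i' : others i, S (val i')}.

(* The profile (j_1, ..., j_(i-1), k, j_(i+1), ..., j_n). *)
Definition insert (i : 'I_n) (k : S i) (j : oprofile i) : profile :=
  [ffun i' : 'I_n =>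
     match eqVneq i' i with
     | EqNotNeq e => ecast z (S z) (esym e) k
     | NeqNotEq ne => j (exist _ i' ne)
     end].

Definition deviation : finType :=
  {x : {i : 'I_n & (S i * S i)%type} | (tagged x).1 != (tagged x).2}.

Definition constraint : finType := (deviation + profile)%type.

Section Forms.
Variable K : comNzRingType.

Definition slice (p : profile -> K) (i : 'I_n) (k : S i) : oprofile i -> K :=
  fun j => p (insert k j).

Definition Hform (i : 'I_n) (Xi : profile -> K) (k l : S i)
    (q : oprofile i -> K) : K :=
  \sum_(j : oprofile i) (Xi (insert k j) - Xi (insert l j)) * q j.

Definition constraint_form (X : 'I_n -> profile -> K) (r : constraint)
    (p : profile -> K) : K :=
  match r with
  | inl x => let: existT i (k, l) := val x in Hform (X i) k l (slice p k)
  | inr j => p j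
  end.

(* The coefficients of a linear form are its values on the standard basis. *)
Definition constraint_mx (X : 'I_n -> profile -> K) :
    'M[K]_(#|constraint|, #|profile|) :=
  \matrix_(r, c) constraint_form X (enum_val r)
                   (fun j => (j == enum_val c)%:R).

End Forms.

Section GenericPayoffs.
Variable R : realType.

(* The payoff tensors whose entries are independent indeterminates. *)
Definition indet_payoff (i : 'I_n) (j : profile) :
    {mpoly R[#|{: 'I_n * profile}|]} := 'X_(enum_rank (i, j)).

(* The D x D minors are indexed by the choice f of D rows. *)
Definition generic_payoff (X : 'I_n -> profile -> R) : Prop :=
  forall f : 'I_#|profile| -> 'I_#|constraint|, injective f ->
    \det (rowsub f (constraint_mx indet_payoff)) != 0 ->
    \det (rowsub f (constraint_mx X)) != 0.

End GenericPayoffs.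
End Tensors.

Record game (R : realType) := Game {
  players : nat;
  strategy : 'I_players -> finType;
  payoff : 'I_players -> profile strategy -> R;
  players_ge2 : (2 <= players)%N;
  strategy_gt0 : forall i, (0 < #|strategy i|)%N
}.

Arguments players {R} g.
Arguments strategy {R} g i.
Arguments payoff {R} g i j.

Section Games.
Variables (R : realType) (G : game R).

Definition generic : Prop := generic_payoff (payoff G).

Definition tensor := {ffun profile (strategy G) -> R^o}.

Definition CE_polytope : set tensor :=
  [set p : tensor |
    [/\ forall j, 0 <= (p j : R),
        \sum_j (p j : R) = 1
      & forall (i : 'I_(players G)) (k l : strategy G i),
          0 <= Hform (payoff G i) k l (slice (p : _ -> R) k)]].

Section Subgame.
Variable T : forall i : 'I_(players G), {set strategy G i}.
Hypothesis T_neq0 : forall i, T i != finset.set0.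

Definition sub_strategy (i : 'I_(players G)) : finType := {s | s \in T i}.

Definition sub_profile (j : profile sub_strategy) : profile (strategy G) :=
  [ffun i => val (j i)].

Lemma sub_strategy_gt0 i : (0 < #|sub_strategy i|)%N.
Proof. by rewrite card_sig card_gt0; exact: T_neq0. Qed.

Definition subgame : game R :=
  @Game R (players G) sub_strategy (fun i j => payoff G i (sub_profile j))
    (players_ge2 G) sub_strategy_gt0.

Definition proper_subgame : Prop := exists i, T i != [set: strategy G i]%SET.

End Subgame.
End Games.

Arguments CE_polytope {R} G _.
Arguments subgame {R} G T T_neq0.
Arguments proper_subgame {R} G T.

Section Affine.
Variable R : realType.

Definition affine_hull (V : lmodType R) (P : set V) : set V :=
  [set x | exists (m : nat) (p : 'I_m -> V) (c : 'I_m -> R),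
     [/\ forall a, P (p a), \sum_a c a = 1 & x = \sum_a c a *: p a]].

(* A relation rather than a function: the empty set has no dimension. *)
Definition has_affine_dim (V : vectType R) (P : set V) (k : nat) : Prop :=
  exists (x0 : V) (U : {vspace V}),
    affine_hull P = [set x | x - x0 \in U] /\ \dim U = k.

Definition affine_on (V W : lmodType R) (A : set V) (f : V -> W) : Prop :=
  forall x y (t : R), A x -> A y ->
    f ((1 - t) *: x + t *: y) = (1 - t) *: f x + t *: f y.

Definition affinely_isomorphic (V W : lmodType R) (P : set V) (Q : set W) :
    Prop :=
  exists f : V -> W,
    [/\ affine_on (affine_hull P) f,
        set_bij (affine_hull P) (affine_hull Q) f
      & f @` P = Q].

Definition full_dimensional (G : game R) : Prop :=
  has_affine_dim (CE_polytope G) #|profile (strategy G)|.-1.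

End Affine.

(* Main.v *)
From HB Require Import structures.
Require Import Defs.
From mathcomp Require Import all_boot all_order all_algebra.
From mathcomp Require Import mpoly.
From mathcomp Require Import boolp classical_sets functions reals.
From mathcomp Require Import ring.

(* By strict complementarity there are nonnegative weights [k] on the incentive
   constraints and [mu] on the coordinates, with vanishing weighted sum of rows,
   and a point [p] of the cone of correlated equilibria such that every row is
   either positive at [p] or has positive weight, but not both.  For each player
   the weights [k] are the jump rates of a Markov chain on the strategies, and
   multiplying stationary measures (Hart and Schmeidler) shows that [p] is
   nonzero and that its support is a product set T.

   Genericity makes the rank of any set of rows maximal among all payoffs.
   To first order this says that, for every tensor [v] killed by the tight rows
   and every relation among these rows that holds on the support of [v], the
   lines of [v] in each direction are stationary for the relation.  Hence the
   tensors spanned by the equilibria are exactly those supported in T whose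
   lines are stationary for [k].

   If no tight constraint H_{a,b} has a <> b and [a] in T, then [p] is interior
   for the subgame on T, and restriction to T is an isomorphism because a
   strategy outside T is never a best response to a distribution supported in T.
   Otherwise let H_{a,b} be such a constraint for player i.  Were the chain of
   another player disconnected, the part of row H_{a,b} on one class would be a
   combination of tight rows, and stationarity would make the edge from a to b a
   circulation.  So the other chains are connected, the slices of [p] in
   direction i are proportional, all incentives of player i between active
   strategies vanish, and the polytope is the single point [p]. *)

Set Implicit Arguments.
Unset Strict Implicit.
Unset Printing Implicit Defensive.

Import Order.TTheory GRing.Theory Num.Theory.

Local Open Scope ring_scope.

(** * Linear inequalities and Markov chains *)

Section LinearInequalities.
Variable R : realFieldType.

Definition dot (J : finType) (a p : J -> R) : R := \sum_j a j * p j.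

Lemma dotDr (J : finType) (a p q : J -> R) c :
  dot a (fun j => p j + c * q j) = dot a p + c * dot a q.
Proof.
rewrite /dot mulr_sumr -big_split; apply: eq_bigr => j _.
by rewrite mulrDr mulrCA.
Qed.

Lemma dotDl (J : finType) (a b p : J -> R) c :
  dot (fun j => a j + c * b j) p = dot a p + c * dot b p.
Proof.
rewrite /dot mulr_sumr -big_split; apply: eq_bigr => j _.
by rewrite mulrDl mulrA.
Qed.

Lemma psum_eq0 (I : finType) (F : I -> R) :
  (forall i, 0 <= F i) -> \sum_i F i = 0 -> forall i, F i = 0.
Proof.
by move=> F0 /eqP; rewrite psumr_eq0// => /allP h i; apply/eqP/h/mem_index_enum.
Qed.

(* Induction on the number of generators: when the separating vector p obtained
   for the tail fails on the head, project everything along the head onto the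
   hyperplane p = 0. *)
Lemma farkas_seq (I J : finType) (s : seq I) (a : I -> J -> R) (b : J -> R) :
  uniq s ->
  (exists2 y : I -> R, (forall i, 0 <= y i) &
     forall j, b j = \sum_(i <- s) y i * a i j) \/
  (exists2 p : J -> R, (forall i, i \in s -> 0 <= dot (a i) p) & dot b p < 0).
Proof.
elim: s a b => [|i0 s IH] a b /=.
  move=> _; case: (boolP [forall j, b j == 0]) => [/forallP b0|].
    by left; exists (fun=> 0) => // j; rewrite big_nil; apply/eqP.
  rewrite negb_forall => /existsP[j0 bj0]; right; exists (fun j => - b j) => //.
  rewrite /dot (bigD1 j0)//= mulrN -expr2 -oppr_gt0 opprD opprK -sumrN.
  apply: ltr_pwDl; first by rewrite lt0r sqrf_eq0 bj0 sqr_ge0.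
  by apply: sumr_ge0 => j _; rewrite mulrN opprK -expr2 sqr_ge0.
move=> /andP[i0s us].
have [[y y0 yb]|[p p0 bp]] := IH a b us.
  left; exists (fun i => if i == i0 then 0 else y i).
    by move=> i; case: ifP.
  move=> j; rewrite big_cons eqxx mul0r add0r yb.
  rewrite big_seq [RHS]big_seq; apply: eq_bigr => i si.
  by case: eqP => // ii0; rewrite -ii0 si in i0s.
case: (lerP 0 (dot (a i0) p)) => [ap0|al0].
  by right; exists p => // i; rewrite inE => /predU1P[->|/p0].
set al := dot (a i0) p in al0.
pose pr (c : J -> R) j := c j + (- (dot c p / al)) * a i0 j.
have alN0 : al != 0 by rewrite lt_eqF.
have [[y y0 yb]|[q q0 bq]] := IH (fun i => pr (a i)) (pr b) us.
  (* The head coefficient restores what the projections removed. It is nonnegative because [dot b p]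
     and [al] are negative while the values of [p] on the tail are nonnegative. *)
  left; exists (fun i => if i == i0 then
      dot b p / al - \sum_(i <- s) y i * (dot (a i) p / al) else y i).
    move=> i; case: ifP => // _; rewrite subr_ge0.
    apply: (@le_trans _ _ 0); last first.
      by apply: mulr_le0; [exact: ltW|rewrite invr_le0 ltW].
    rewrite big_seq; apply: sumr_le0 => k ks; apply: mulr_ge0_le0 => //.
    by apply: mulr_ge0_le0; [exact: p0|rewrite invr_le0 ltW].
  move=> j; rewrite big_cons eqxx.
  have -> : \sum_(i <- s) (if i == i0 then dot b p / al -
      \sum_(i <- s) y i * (dot (a i) p / al) else y i) * a i j =
      \sum_(i <- s) y i * a i j.
    rewrite big_seq [RHS]big_seq; apply: eq_bigr => i si.
    by case: eqP => // ii0; rewrite -ii0 si in i0s.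
  have := yb j; rewrite /pr.
  under eq_bigr do rewrite mulrDr mulNr mulrN mulrA.
  rewrite big_split sumrN -mulr_suml /= => h.
  rewrite mulrBl addrAC; apply/eqP.
  move/eqP: h; rewrite mulNr subr_eq => /eqP ->; apply/eqP; ring.
right; exists (fun j => q j + (- (dot (a i0) q / al)) * p j).
  move=> i; rewrite inE => /predU1P[->|si].
    by rewrite dotDr -/al mulNr divfK// subrr.
  rewrite dotDr; have := q0 i si; rewrite /pr dotDl.
  by congr (_ <= _ + _); rewrite !mulNr mulrAC [in RHS]mulrAC [dot (a i) p * _]mulrC.
move: bq; rewrite /pr dotDl dotDr.
by congr (_ + _ < _); rewrite !mulNr mulrAC [in RHS]mulrAC [dot b p * _]mulrC.
Qed.

Lemma farkas (I J : finType) (a : I -> J -> R) (b : J -> R) :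
  (exists2 y : I -> R, (forall i, 0 <= y i) &
     forall j, b j = \sum_i y i * a i j) \/
  (exists2 p : J -> R, (forall i, 0 <= dot (a i) p) & dot b p < 0).
Proof.
have [[y y0 h]|[p p0 h]] := farkas_seq a b (index_enum_uniq I).
  by left; exists y.
by right; exists p => // i; apply: p0; exact: mem_index_enum.
Qed.

(* Tucker's theorem; the two nonnegative terms in the last item have zero
   product since [y] annihilates [a]. *)
Lemma strict_complementarity (I J : finType) (a : I -> J -> R) :
  exists (y : I -> R) (p : J -> R),
  [/\ forall i, 0 <= y i, forall j, \sum_i y i * a i j = 0,
      forall i, 0 <= dot (a i) p & forall i, 0 < y i + dot (a i) p].
Proof.
(* Farkas against minus one row: either a relation gives this row positive weight, or some vector is
   positive on it. Summing over all rows settles them simultaneously. *)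
have one i0 : exists yp : (I -> R) * (J -> R),
    [/\ forall i, 0 <= yp.1 i, forall j, \sum_i yp.1 i * a i j = 0,
      forall i, 0 <= dot (a i) yp.2 & 0 < yp.1 i0 + dot (a i0) yp.2].
  have [[y y0 h]|[p p0 h]] := farkas a (fun j => - a i0 j).
    exists (fun i => y i + (i == i0)%:R, fun=> 0); split => /=.
    - by move=> i; rewrite addr_ge0.
    - move=> j; under eq_bigr do rewrite mulrDl.
      rewrite big_split /= -h (bigD1 i0)//= eqxx mul1r big1 ?addr0 ?addNr//.
      by move=> i /negbTE->; rewrite mul0r.
    - by move=> i; rewrite /dot big1// => j _; rewrite mulr0.
    - rewrite eqxx /dot big1 ?addr0 => [|j _]; last by rewrite mulr0.
      by rewrite ltr_wpDl.
  exists (fun=> 0, p); split => //=.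
  - by move=> j; rewrite big1// => i _; rewrite mul0r.
  - rewrite add0r; move: h; rewrite /dot.
    by under eq_bigr do rewrite mulNr; rewrite sumrN oppr_lt0.
have [yp H] := choice one.
exists (fun i => \sum_k (yp k).1 i), (fun j => \sum_k (yp k).2 j).
have dotE i : dot (a i) (fun j => \sum_k (yp k).2 j) = \sum_k dot (a i) (yp k).2.
  rewrite /dot; under eq_bigr do rewrite mulr_sumr.
  by rewrite exchange_big.
split.
- by move=> i; apply: sumr_ge0 => k _; have [] := H k.
- move=> j; under eq_bigr do rewrite mulr_suml.
  by rewrite exchange_big big1// => k _; have [] := H k.
- by move=> i; rewrite dotE; apply: sumr_ge0 => k _; have [] := H k.
move=> i; rewrite dotE -big_split/= (bigD1 i)//=.
apply: ltr_pwDl; first by have [] := H i.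
apply: sumr_ge0 => k _; have [h1 _ h2 _] := H k.
by rewrite addr_ge0.
Qed.

(** Farkas' lemma for the generators and their negatives: the weights lose their sign, and a
    separating vector is killed by every generator. *)
Lemma bipolar_span (I J : finType) (a : I -> J -> R) (b : J -> R) :
  (forall p, (forall i, dot (a i) p = 0) -> dot b p = 0) ->
  exists y : I -> R, forall j, b j = \sum_i y i * a i j.
Proof.
move=> ab; pose a' (x : I + I) :=
  match x with inl i => a i | inr i => fun j => - a i j end.
have [[y _ h]|[p p0 h]] := farkas a' b.
  exists (fun i => y (inl i) - y (inr i)) => j.
  rewrite h big_sumType /= -big_split /=; apply: eq_bigr => i _.
  by rewrite mulrN mulrBl.
suff /ab E : forall i, dot (a i) p = 0 by rewrite E ltxx in h.
move=> i; apply: le_anti; rewrite (p0 (inl i)) andbT.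
have := p0 (inr i); rewrite /dot /=.
by under eq_bigr do rewrite mulNr; rewrite sumrN oppr_ge0.
Qed.

Lemma small_perturbation (I : finType) (a b : I -> R) :
  (forall i, 0 < a i) -> exists2 e, 0 < e & forall i, 0 <= a i + e * b i.
Proof.
move=> a0; suff [e e0 h] : exists2 e, 0 < e &
    forall i, i \in enum I -> 0 <= a i + e * b i.
  by exists e => // i; apply: h; rewrite mem_enum.
elim: (enum I) => [|i s [e e0 IH]]; first by exists 1.
pose d := a i / (1 + `|b i|).
have n0 : 0 < 1 + `|b i| by rewrite ltr_pwDl.
have d0 : 0 < d by rewrite divr_gt0.
exists (Num.min e d) => [|k]; first by rewrite lt_min e0.
have m0 : 0 <= Num.min e d by rewrite le_min !ltW.
have low x k' : Num.min e d <= x -> 0 <= a k' + x * b k' -> 0 <= a k' + Num.min e d * b k'.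
  move=> mx; case: (lerP 0 (b k')) => [b0 _|b0].
    by rewrite addr_ge0 ?mulr_ge0// ltW.
  by move/le_trans; apply; rewrite lerD2l ler_wnM2r// ltW.
rewrite inE => /predU1P[->|ks]; last by apply: (low e); [rewrite ge_min lexx|exact: IH].
apply: (low d); first by rewrite ge_min lexx orbT.
have : - `|b i| <= b i by rewrite lerNl ler_normr lexx orbT.
have : d * (1 + `|b i|) = a i by rewrite divfK// gt_eqF.
move=> <- h; rewrite mulrDr mulr1 -addrA -mulrDr addr_ge0 ?(ltW d0)//.
by rewrite mulr_ge0 ?(ltW d0)// -lerBlDl sub0r.
Qed.

End LinearInequalities.

(** * Stationary measures and Dirichlet forms of finite Markov chains *)

Section MarkovChains.
Variables (R : realFieldType) (S : finType) (lam : S -> S -> R).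
Hypothesis lam_ge0 : forall k l, 0 <= lam k l.

(** Global balance for the jump rates [lam]. Diagonal rates cancel, and [w] may be signed. *)
Definition stationary1 (w : S -> R) : Prop :=
  forall k, (\sum_l lam k l) * w k = \sum_m lam m k * w m.

(* By complementarity a stationary measure charges every maximum of the
   complementary function. *)
Lemma stationary1_exists (s0 : S) :
  exists w : S -> R, [/\ forall k, 0 <= w k, exists k, 0 < w k & stationary1 w].
Proof.
pose Q k l := lam k l - (k == l)%:R * \sum_m lam k m.
have [w [g [w0 wQ _ wg]]] := strict_complementarity Q.
exists w; split => //; last first.
  move=> l; have := wQ l; rewrite /Q.
  under eq_bigr do rewrite mulrBr mulrC.
  rewrite big_split sumrN /= => /eqP; rewrite subr_eq0 => /eqP ->.
  rewrite [RHS](bigD1 l)//= eqxx mul1r [X in _ + X]big1 ?addr0 1?mulrC// => k /negbTE ->.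
  by rewrite mul0r mulr0.
have [k _ kmax] := @arg_maxP _ R S s0 predT g isT.
exists k; have := wg k; suff : dot (Q k) g <= 0.
  by move=> h h'; rewrite (lt_le_trans h')// gerDl.
have -> : dot (Q k) g = \sum_l lam k l * (g l - g k).
  rewrite /dot /Q; under eq_bigr do rewrite mulrBl.
  under [RHS]eq_bigr do rewrite mulrBr.
  rewrite !big_split !sumrN /=; congr (_ - _).
  rewrite -mulr_suml (bigD1 k)//= eqxx mul1r [X in _ + X]big1 ?addr0 // => l.
  by rewrite eq_sym => /negbTE ->; rewrite !mul0r.
apply: sumr_le0 => l _; apply: mulr_ge0_le0 => //.
by rewrite subr_le0; apply: kmax.
Qed.

Variable w : S -> R.
Hypotheses (w_ge0 : forall k, 0 <= w k) (w_stat : stationary1 w).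

(** After expanding the square, stationarity exchanges [h l ^+ 2] for [h k ^+ 2]. *)
Lemma dirichlet_form (h : S -> R) :
  \sum_k \sum_l lam k l * w k * (h k - h l) ^+ 2 =
  2 * \sum_k \sum_l lam k l * w k * h k * (h k - h l).
Proof.
have E : \sum_k \sum_l lam k l * w k * h l ^+ 2 =
         \sum_k \sum_l lam k l * w k * h k ^+ 2.
  rewrite exchange_big; apply: eq_bigr => k _ /=.
  by rewrite -!mulr_suml w_stat.
transitivity (\sum_k \sum_l lam k l * w k * h l ^+ 2 +
  \sum_k \sum_l (lam k l * w k * h k ^+ 2 - 2 * (lam k l * w k * h k * h l))).
  rewrite -big_split; apply: eq_bigr => k _ /=; rewrite -big_split.
  by apply: eq_bigr => l _ /=; ring.
rewrite E mulr_sumr -big_split; apply: eq_bigr => k _ /=.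
rewrite mulr_sumr -big_split; apply: eq_bigr => l _ /=; ring.
Qed.

Lemma dirichlet_form0 (h : S -> R) k l :
  \sum_k \sum_l lam k l * w k * h k * (h k - h l) = 0 ->
  0 < lam k l -> w k != 0 -> h k = h l.
Proof.
move=> H0 lam0 wk; have := dirichlet_form h; rewrite H0 mulr0 => E.
have nn a b : 0 <= lam a b * w a * (h a - h b) ^+ 2.
  by apply: mulr_ge0; [apply: mulr_ge0|apply: sqr_ge0].
have /(_ k) := psum_eq0 (fun a => sumr_ge0 _ (fun b _ => nn a b)) E.
move/(psum_eq0 (nn k))/(_ l)/eqP.
by rewrite !mulf_eq0 (negbTE wk) gt_eqF//= orbb subr_eq0 => /eqP.
Qed.

(** Multiplying the equation at each state by [w] and [x] gives zero Dirichlet energy. *)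
Lemma harmonic_edge (x : S -> R) k l :
  (forall k, w k != 0 -> \sum_l lam k l * (x k - x l) = 0) ->
  0 < lam k l -> w k != 0 -> x k = x l.
Proof.
move=> harm; apply: dirichlet_form0; apply: big1 => a _.
have [->|/harm E] := eqVneq (w a) 0.
  by apply: big1 => b _; rewrite mulr0 !mul0r.
transitivity (w a * x a * \sum_l lam a l * (x a - x l)); last by rewrite E mulr0.
rewrite mulr_sumr; apply: eq_bigr => b _; ring.
Qed.

(** The density of [v] with respect to [w] has zero Dirichlet energy, since that energy is a
    combination of the balance defects of [v]. *)
Lemma stationary1_ratio (v : S -> R) k l :
  stationary1 v -> (forall k, w k = 0 -> v k = 0) -> 0 < lam k l ->
  w k * v l = w l * v k.
Proof.
move=> v_stat supp lam0.
have [wk|wk] := eqVneq (w k) 0; first by rewrite wk (supp _ wk) mul0r mulr0.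
pose h k := v k / w k.
have vE a : v a = h a * w a.
  rewrite /h; have [wa|wa] := eqVneq (w a) 0; last by rewrite divfK.
  by rewrite wa (supp _ wa) mulr0.
suff E : h k = h l by rewrite !vE E; ring.
apply: dirichlet_form0 lam0 wk.
transitivity (\sum_a h a * ((\sum_b lam a b) * v a - \sum_b lam b a * v b)).
  have -> : \sum_k \sum_l lam k l * w k * h k * (h k - h l) =
    \sum_k \sum_l lam k l * w k * h k * h k -
    \sum_k \sum_l lam k l * w k * h k * h l.
    rewrite -sumrB; apply: eq_bigr => a _; rewrite -sumrB.
    by apply: eq_bigr => b _; rewrite mulrBr.
  rewrite [X in _ - X]exchange_big -sumrB; apply: eq_bigr => a _ /=.
  rewrite mulrBr mulr_suml !mulr_sumr; congr (_ - _); apply: eq_bigr => b _;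
  rewrite vE; ring.
by apply: big1 => a _; rewrite v_stat subrr mulr0.
Qed.

End MarkovChains.

(** * Tangent spaces of determinantal varieties *)

Section Rank.
Variable F : numFieldType.

Lemma poly_eq0_everywhere (p : {poly F}) : (forall t, p.[t] = 0) -> p = 0.
Proof.
move=> p0; apply/eqP/negPn/negP => pN0.
have := max_poly_roots (rs := [seq i%:R | i <- iota 0 (size p)]) pN0.
rewrite size_map size_iota ltnn => H; suff: false by []; apply: H.
  by apply/allP => t _; apply/rootP.
by rewrite map_inj_uniq ?iota_uniq// => a b /eqP; rewrite eqr_nat => /eqP.
Qed.

(* The matrices of rank at most [\rank A] are a variety whose tangent space at
   [A] consists of the [B] mapping the kernel of [A] into its image. *)
Lemma rank_tangent m n (A B : 'M[F]_(m, n)) (u : 'rV_m) (v : 'cV_n) :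
  (forall t, \rank (A + t *: B)%R <= \rank A)%N -> u *m A = 0 -> A *m v = 0 ->
  u *m B *m v = 0.
Proof.
move=> rk uA Av.
have [P P1] := row_fullP (col_base_full A).
have [Q Q1] := row_freeP (row_base_free A).
have PAQ : P *m A *m Q = 1%:M.
  rewrite -[A in P *m A](mulmx_base A) mulmxA P1 mul1mx.
  exact: Q1.
(* [P] and [Q] reduce [A] to an identity block. [N] is the minor of [A + t *: B] bordered by [u] and
   [v], of size one above the rank, with a factor [t] removed from its last row; at 0 its
   determinant is [u *m B *m v]. *)
pose N : 'M[{poly F}]_(\rank A + 1) :=
  block_mx (1%:M + 'X *: map_mx polyC (P *m B *m Q))
           ('X *: map_mx polyC (P *m B *m v))
           (map_mx polyC (u *m B *m Q)) (map_mx polyC (u *m B *m v)).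
have Nt t : map_mx (horner_eval t) N =
  block_mx (1%:M + t *: (P *m B *m Q)) (t *: (P *m B *m v))
           (u *m B *m Q) (u *m B *m v).
  rewrite /N map_block_mx; congr block_mx; apply/matrixP => i j;
  by rewrite !mxE /horner_eval !hornerE ?hornerMn ?hornerE.
have tN t : t * (\det N).[t] = 0.
  have -> : (\det N).[t] = \det (map_mx (horner_eval t) N).
    by rewrite det_map_mx.
  have : \det (col_mx P u *m (A + t *: B) *m row_mx Q v) = 0.
    apply/eqP; apply: contraTT isT => dN0.
    have : col_mx P u *m (A + t *: B) *m row_mx Q v \in unitmx.
      by rewrite unitmxE unitfE.
    rewrite -row_free_unit -row_leq_rank => h.
    have h1 := leq_trans h (mxrankM_maxl _ _).
    have h2 := leq_trans h1 (mxrankM_maxr _ _).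
    have := leq_trans h2 (rk t).
    by rewrite addn1 ltnn.
  rewrite mul_col_mx mul_col_row.
  have -> : P *m (A + t *: B) *m Q = 1%:M + t *: (P *m B *m Q).
    by rewrite mulmxDr mulmxDl PAQ -scalemxAr -scalemxAl.
  have -> : P *m (A + t *: B) *m v = t *: (P *m B *m v).
    by rewrite mulmxDr mulmxDl -[P *m A *m v]mulmxA Av mulmx0 add0r
               -scalemxAr -scalemxAl.
  have -> : u *m (A + t *: B) *m Q = t *: (u *m B *m Q).
    by rewrite mulmxDr mulmxDl uA mul0mx add0r -scalemxAr -scalemxAl.
  have -> : u *m (A + t *: B) *m v = t *: (u *m B *m v).
    by rewrite mulmxDr mulmxDl uA mul0mx add0r -scalemxAr -scalemxAl.
  have -> : block_mx (1%:M + t *: (P *m B *m Q)) (t *: (P *m B *m v))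
      (t *: (u *m B *m Q)) (t *: (u *m B *m v)) =
    block_mx 1%:M 0 0 t%:M *m map_mx (horner_eval t) N.
    by rewrite Nt mulmx_block !mul1mx !mul0mx !addr0 !add0r !mul_scalar_mx.
  by rewrite det_mulmx det_lblock det1 mul1r det_scalar1.
have N0 : \det N = 0.
  apply/eqP; have /eqP : 'X * \det N = 0.
    by apply: poly_eq0_everywhere => t; rewrite hornerM hornerX.
  by rewrite mulf_eq0 polyX_eq0.
have : \det (map_mx (horner_eval 0) N) = 0.
  by rewrite det_map_mx N0 rmorph0.
rewrite Nt !scale0r addr0 det_lblock det1 mul1r => d0.
by rewrite [LHS]mx11_scalar -det_mx11 d0 raddf0.
Qed.

Lemma row_free_rowsub m n r (g : 'I_r -> 'I_m) (A : 'M[F]_(m, n)) :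
  injective g -> row_free A -> row_free (rowsub g A).
Proof.
move=> gi /row_freeP[B AB]; apply/row_freeP; exists (colsub g B).
rewrite -mxsub_mul AB; apply/matrixP => i j; rewrite !mxE.
by rewrite (inj_eq gi).
Qed.

Lemma row_free_rowsub_inj m n r (g : 'I_r -> 'I_m) (A : 'M[F]_(m, n)) :
  row_free (rowsub g A) -> injective g.
Proof.
move=> /row_freeP[B AB] a b gab; apply/eqP.
have : (rowsub g A *m B) a b = (rowsub g A *m B) b b.
  by rewrite !mxE; apply: eq_bigr => k _; rewrite !mxE gab.
by rewrite AB !mxE eqxx; case: eqP => // _ /eqP; rewrite eq_sym oner_eq0.
Qed.

(** Steinitz completion, adding one row outside the current span at a time. It produces the
    full-size minors that genericity speaks about. *)
Lemma row_free_complete m n r (A : 'M[F]_(m, n)) (g : 'I_r -> 'I_m) :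
  row_full A -> row_free (rowsub g A) ->
  exists2 f : 'I_n -> 'I_m, row_free (rowsub f A) &
    exists h : 'I_r -> 'I_n, forall a, g a = f (h a).
Proof.
move=> fA gA; have rn : (r <= n)%N.
  by have /eqP <- := gA; apply: rank_leq_col.
move: rn; move dE : (n - r)%N => d.
elim: d r g gA dE => [|d IH] r g gA dE rn.
  have E : r = n by apply/eqP; rewrite eqn_leq rn -subn_eq0 dE.
  by move: g gA; rewrite E => g gA; exists g => //; exists id.
have [k kP] : exists k, ~~ (row k A <= rowsub g A)%MS.
  apply/existsP; rewrite -negb_forall; apply/negP => /forallP H.
  have /mxrankS : (A <= rowsub g A)%MS by apply/row_subP.
  have /eqP -> := fA; have /eqP -> := gA => nr.
  by move: dE; move: nr; rewrite -subn_eq0 => /eqP ->.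
pose g' (a : 'I_(1 + r)) := match fintype.split a with inl _ => k | inr b => g b end.
have g'E : rowsub g' A = col_mx (row k A) (rowsub g A).
  apply/matrixP => a b; rewrite !mxE /g'; case: fintype.split => c; by rewrite !mxE.
have g'A : row_free (rowsub g' A).
  rewrite -row_leq_rank g'E -addsmxE.
  rewrite add1n; have /eqP {1}<- : \rank (rowsub g A) == r by exact: gA.
  rewrite (ltn_leqif (mxrank_leqif_sup (addsmxSr _ _))).
  by apply: contra kP => /(submx_trans (addsmxSl _ _)).
have [||f fA' [h hE]] := IH _ g' g'A.
- by rewrite add1n subnS dE.
- by rewrite add1n -subn_gt0 dE.
exists f => //; exists (fun a => h (rshift 1 a)) => a.
rewrite -hE /g'; case: splitP => [[b blt] /= E|b /= E]; first by rewrite -E in blt.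
congr g; apply: val_inj => /=; exact: (@addnI 1).
Qed.

End Rank.

(** * Deviations in tensor games *)

Section Profiles.
Variables (n : nat) (S : 'I_n -> finType).
Implicit Types (j : profile S) (i : 'I_n).

Definition upd j i (l : S i) : profile S :=
  [ffun i' => match eqVneq i' i with
    | EqNotNeq e => ecast z (S z) (esym e) l
    | NeqNotEq _ => j i'
    end].

Lemma updE j i (l : S i) : upd j l i = l.
Proof.
by rewrite ffunE; case: (eqVneq i i) => [e|/eqP//]; rewrite eq_axiomK.
Qed.

Lemma updNE j i (l : S i) i' : i' != i -> upd j l i' = j i'.
Proof. by move=> ne; rewrite ffunE; case: eqVneq ne. Qed.

Lemma profileP j j' : (forall i, j i = j' i) -> j = j'.
Proof. by move=> h; apply/ffunP. Qed.

Lemma upd_id j i : upd j (j i) = j.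
Proof.
apply: profileP => i'; have [->|ne] := eqVneq i' i; first by rewrite updE.
by rewrite updNE.
Qed.

Lemma updK j i (k l : S i) : upd (upd j k) l = upd j l.
Proof.
apply: profileP => i'; have [->|ne] := eqVneq i' i; first by rewrite !updE.
by rewrite !updNE.
Qed.

Lemma updC j i i' (k : S i) (l : S i') : i != i' ->
  upd (upd j k) l = upd (upd j l) k.
Proof.
move=> ii'; apply: profileP => a; have [->|ne] := eqVneq a i.
  by rewrite updNE// !updE.
have [->|ne'] := eqVneq a i'; last by rewrite !updNE.
by rewrite updE [RHS]updNE ?updE// eq_sym.
Qed.

Lemma insertE i (k : S i) (q : oprofile S i) : insert k q i = k.
Proof.
by rewrite ffunE; case: (eqVneq i i) => [e|/eqP//]; rewrite eq_axiomK.
Qed.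

Lemma insertNE i (k : S i) (q : oprofile S i) i' (ne : i' != i) :
  insert k q i' = q (exist _ i' ne).
Proof.
rewrite ffunE; case: eqVneq => [e|ne']; first by exfalso; move: (ne); rewrite e eqxx.
by congr (q (exist _ _ _)); exact: bool_irrelevance.
Qed.

Lemma upd_insert i (k l : S i) (q : oprofile S i) :
  upd (insert k q) l = insert l q.
Proof.
apply: profileP => i'; have [->|ne] := eqVneq i' i.
  by rewrite updE insertE.
by rewrite updNE// !insertNE.
Qed.

Definition restr i j : oprofile S i := [ffun i' => j (val i')].

Lemma insert_restr i (k : S i) j : j i = k -> insert k (restr i j) = j.
Proof.
move=> <-; apply: profileP => i'; have [->|ne] := eqVneq i' i.
  by rewrite insertE.
by rewrite insertNE ffunE.
Qed.

Lemma restr_insert i (k : S i) (q : oprofile S i) : restr i (insert k q) = q.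
Proof.
by apply/ffunP => -[i' ne]; rewrite ffunE insertNE.
Qed.

Variable R : realType.
Implicit Types (X Y : 'I_n -> profile S -> R) (v : profile S -> R).

(** The incentive constraint as a row on the whole tensor space; [Hform_dev] identifies [dev] with
    the form on a slice. *)
Definition coef X i (k l : S i) j : R :=
  (j i == k)%:R * (X i j - X i (upd j l)).

Definition dev X i (k l : S i) v : R := dot (coef X k l) v.

Lemma Hform_dev X i (k l : S i) v : Hform (X i) k l (slice v k) = dev X k l v.
Proof.
rewrite /dev /dot (bigID (fun j => j i == k)) /= [X in _ + X]big1 ?addr0; last first.
  by move=> j /negbTE h; rewrite /coef h !mul0r.
rewrite (reindex_onto (insert k) (restr i)); last first.
  by move=> j /eqP; exact: insert_restr.
apply: eq_big => [q|q _]; first by rewrite insertE restr_insert !eqxx.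
by rewrite /coef insertE eqxx mul1r upd_insert.
Qed.

(** Weights on the incentive constraints, read as jump rates. No sign is imposed, because signed
    relations among the rows occur as well. *)
Definition rates := forall i, S i -> S i -> R.
Implicit Type k : rates.

Definition flow k X j : R :=
  \sum_i \sum_l k i (j i) l * (X i j - X i (upd j l)).

Definition stationary_in k i v : Prop :=
  forall j, (\sum_l k i (j i) l) * v j = \sum_m k i m (j i) * v (upd j m).

Lemma flow_coef k X j :
  flow k X j = \sum_i \sum_a \sum_b k i a b * coef X a b j.
Proof.
apply: eq_bigr => i _; rewrite [RHS](bigD1 (j i))//= [X in _ + X]big1 ?addr0.
  by apply: eq_bigr => b _; rewrite /coef eqxx mul1r.
move=> a; rewrite eq_sym => /negbTE h; apply: big1 => b _.
by rewrite /coef h mul0r mulr0.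
Qed.

Lemma flow_dev k X v :
  dot (flow k X) v = \sum_i \sum_a \sum_b k i a b * dev X a b v.
Proof.
rewrite /dot; under eq_bigr do rewrite flow_coef mulr_suml.
rewrite exchange_big; apply: eq_bigr => i _ /=.
under eq_bigr do rewrite mulr_suml.
rewrite exchange_big; apply: eq_bigr => a _ /=.
under eq_bigr do rewrite mulr_suml.
rewrite exchange_big; apply: eq_bigr => b _ /=.
by rewrite /dev /dot mulr_sumr; apply: eq_bigr => j _; rewrite -mulrA.
Qed.

Lemma sum_tag (F : forall i, S i -> S i -> R) :
  \sum_i \sum_a \sum_b F i a b =
  \sum_(x : {i : 'I_n & (S i * S i)%type}) F (tag x) (tagged x).1 (tagged x).2.
Proof.
have E i : \sum_a \sum_b F i a b = \sum_(x : S i * S i) F i x.1 x.2.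
  by rewrite pair_big.
under eq_bigr do rewrite E.
exact: (sig_big_dep (fun=> true) (fun _ _ => true) (fun i x => F i x.1 x.2)).
Qed.

Lemma sum_deviation (F : forall i, S i -> S i -> R) :
  (forall i a, F i a a = 0) ->
  \sum_i \sum_a \sum_b F i a b =
  \sum_(x : deviation S) F (tag (val x)) (tagged (val x)).1 (tagged (val x)).2.
Proof.
move=> F0; rewrite sum_tag (bigID (fun x => (tagged x).1 != (tagged x).2)) /=.
rewrite [X in _ + X]big1 ?addr0; last first.
  by move=> [i [a b]] /= /negPn/eqP ->.
exact: (big_sub (fun x : {i : 'I_n & (S i * S i)%type} => (tagged x).1 != (tagged x).2)
  (fun x => F (tag x) (tagged x).1 (tagged x).2)).
Qed.

Lemma dev_diag X i (a : S i) v : dev X a a v = 0.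
Proof.
apply: big1 => j _; rewrite /coef; case: eqP => [<-|]; last by rewrite !mul0r.
by rewrite upd_id subrr mulr0 mul0r.
Qed.

End Profiles.

(** * Generic payoffs *)

Section GenericTangent.
Variables (n : nat) (S : 'I_n -> finType) (R : realType).
Implicit Types (X Y : 'I_n -> profile S -> R) (v : profile S -> R).

Lemma constraint_mx_indet X :
  map_mx (mpoly.meval (fun a : 'I_#|{: 'I_n * profile S}| =>
            X (enum_val a).1 (enum_val a).2))
    (constraint_mx (@indet_payoff n S R)) = constraint_mx X.
Proof.
apply/matrixP => r c; rewrite !mxE.
case: (enum_val r) => [[[i [k l]] h]|j] /=; last by rewrite /= rmorph_nat.
rewrite /Hform rmorph_sum; apply: eq_bigr => q _ /=.
by rewrite rmorphM rmorphB /= /slice rmorph_nat /indet_payoff !mpoly.mevalXU !enum_rankK.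
Qed.

Lemma constraint_mx_inl X (x : deviation S) (c : 'I_#|profile S|) :
  constraint_mx X (enum_rank (inl x)) c =
  coef X (tagged (val x)).1 (tagged (val x)).2 (enum_val c).
Proof.
rewrite mxE enum_rankK /=; case: x => [[i [k l]] h] /=.
rewrite Hform_dev /dev /dot (bigD1 (enum_val c))//= eqxx mulr1 big1 ?addr0//.
by move=> j /negbTE ->; rewrite mulr0.
Qed.

Lemma constraint_mx_inr X (j : profile S) (c : 'I_#|profile S|) :
  constraint_mx X (enum_rank (inr j)) c = (j == enum_val c)%:R.
Proof. by rewrite mxE enum_rankK. Qed.

Lemma constraint_mx_full X : row_full (constraint_mx X).
Proof.
apply/row_fullP; exists (rowsub (fun c => enum_rank (inr (enum_val c))) 1%:M).
rewrite -rowsubE; apply/matrixP => a b; rewrite mxE constraint_mx_inr mxE.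
by rewrite (inj_eq enum_val_inj).
Qed.

(** A minor that is nonzero at some payoffs [X'] is a nonzero polynomial, so genericity applies to
    it. *)
Lemma generic_det X X' (f : 'I_#|profile S| -> 'I_#|constraint S|) :
  generic_payoff X -> row_free (rowsub f (constraint_mx X')) ->
  row_free (rowsub f (constraint_mx X)).
Proof.
move=> gen fX'; have fi := row_free_rowsub_inj fX'.
move: fX'; rewrite !row_free_unit !unitmxE !unitfE => fX'.
apply: gen => //; apply/eqP => d0; case/negP: fX'.
by rewrite -constraint_mx_indet -map_mxsub det_map_mx d0 rmorph0.
Qed.

(** Rows outside [b] are zeroed rather than deleted, so that all matrices share one size. *)
Definition masked_mx (b : pred (constraint S)) X : 'M[R]_(_, _) :=
  \matrix_(r, c) ((b (enum_val r))%:R * constraint_mx X r c).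

(** A maximal independent set of selected rows at [X'] is completed to a basis of rows, the minor is
    carried over to [X], and the added rows are dropped again. *)
Lemma generic_rank X X' b : generic_payoff X ->
  (\rank (masked_mx b X') <= \rank (masked_mx b X))%N.
Proof.
move=> gen.
set g := maxrankfun (masked_mx b X').
have gF : row_free (rowsub g (masked_mx b X')) := maxrowsub_free _.
have gb a : b (enum_val (g a)).
  apply: contraT => /negbTE bN; have /row_freeP[B AB] := gF.
  have := erefl ((rowsub g (masked_mx b X') *m B) a a); rewrite {1}AB !mxE eqxx.
  rewrite big1 => [/eqP|k _]; first by rewrite oner_eq0.
  by rewrite !mxE bN !mul0r.
have gE Z : rowsub g (masked_mx b Z) = rowsub g (constraint_mx Z).
  by apply/matrixP => a c; rewrite mxE [LHS]mxE gb mul1r [RHS]mxE.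
rewrite gE in gF.
have [f fF [h hE]] := row_free_complete (constraint_mx_full X') gF.
have gi := row_free_rowsub_inj gF.
have hi : injective h by move=> x y xy; apply: gi; rewrite !hE xy.
have := row_free_rowsub hi (generic_det gen fF).
have -> : rowsub h (rowsub f (constraint_mx X)) = rowsub g (masked_mx b X).
  by rewrite gE; apply/matrixP => a c; rewrite !mxE hE.
rewrite -row_leq_rank => /leq_trans; apply.
by rewrite rowsubE; apply: mxrankM_maxr.
Qed.

Lemma sum_enum_val (T : finType) (F : T -> R) :
  \sum_(r < #|T|) F (enum_val r) = \sum_x F x.
Proof.
rewrite [RHS](reindex (@enum_val T T))//.
exact: onW_bij (@enum_val_bij T).
Qed.

(** [rank_tangent] in the direction [Y], for the incentive rows of nonzero weight and the coordinate
    rows where [v] vanishes. The right kernel contains [v]; the left kernel contains [k], completed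
    by minus the flow on the coordinates. *)
Lemma generic_tangent X Y (k : rates S R) v : generic_payoff X ->
  (forall i a b, k i a b != 0 -> dev X a b v = 0) ->
  (forall j, v j != 0 -> flow k X j = 0) ->
  dot (flow k Y) v = 0.
Proof.
move=> gen kv vk; pose kx (x : deviation S) := k _ (tagged (val x)).1 (tagged (val x)).2.
have fE Z j : flow k Z j = \sum_(x : deviation S)
    kx x * coef Z (tagged (val x)).1 (tagged (val x)).2 j.
  rewrite flow_coef sum_deviation// => i a.
  by rewrite /coef; case: eqP => [<-|]; rewrite ?upd_id ?subrr !(mul0r, mulr0).
pose b (r : constraint S) := match r with inl x => kx x != 0 | inr j => v j == 0 end.
pose M := masked_mx b.
pose B : 'M[R]_(#|constraint S|, #|profile S|) :=
  \matrix_(r, c) match enum_val r with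
    | inl x => (b (inl x))%:R * constraint_mx Y r c | inr _ => 0 end.
pose u : 'rV[R]_#|constraint S| := \row_r
  match enum_val r with inl x => kx x | inr j => - flow k X j end.
pose w : 'cV[R]_#|profile S| := \col_c v (enum_val c).
have kxb x : kx x * (b (inl x))%:R = kx x.
  by rewrite /b; case: eqP => [->|]; rewrite ?mulr1 ?mulr0.
have MB t : M X + t *: B = M (fun i j => X i j + t * Y i j).
  apply/matrixP => r c; rewrite -(enum_valK r).
  rewrite [LHS]mxE [RHS]mxE [M X _ _]mxE [(t *: B) _ _]mxE [B _ _]mxE enum_rankK.
  case: (enum_val r) => [x|j]; last by rewrite !constraint_mx_inr mulr0 addr0.
  by rewrite !constraint_mx_inl /coef; ring.
have uM : u *m M X = 0.
  apply/matrixP => a c; rewrite !mxE.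
  pose F (r : constraint S) := match r with inl x => kx x | inr j => - flow k X j end
     * ((b r)%:R * constraint_mx X (enum_rank r) c).
  transitivity (\sum_(r < #|constraint S|) F (enum_val r)).
    by apply: eq_bigr => r _; rewrite !mxE /F enum_valK mxE.
  rewrite sum_enum_val big_sumType /F.
  under eq_bigr do rewrite constraint_mx_inl mulrA kxb.
  rewrite -fE (bigD1 (enum_val c))//= constraint_mx_inr eqxx mulr1.
  rewrite [X in _ + (_ + X)]big1 ?addr0; last first.
    by move=> j /negbTE jc; rewrite constraint_mx_inr jc !mulr0.
  have [_|/vk ->] := eqVneq (v (enum_val c)) 0; first by rewrite mulr1 subrr.
  by rewrite oppr0 mul0r addr0.
have Mw : M X *m w = 0.
  apply/matrixP => r a; rewrite !mxE -(enum_valK r).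
  transitivity ((b (enum_val r))%:R *
      \sum_c constraint_mx X (enum_rank (enum_val r)) c * v (enum_val c)).
    by rewrite mulr_sumr; apply: eq_bigr => c _; rewrite !mxE enum_rankK mulrA.
  case: (enum_val r) => [x|j].
    under eq_bigr do rewrite constraint_mx_inl.
    rewrite (sum_enum_val (fun j => coef X (tagged (val x)).1 (tagged (val x)).2 j * v j)).
    rewrite -/(dot _ _) -/(dev _ _ _ _) /=.
    by have [|/kv ->] := eqVneq (kx x) 0; rewrite ?mulr0 ?mul0r.
  under eq_bigr do rewrite constraint_mx_inr.
  rewrite (sum_enum_val (fun c => (j == c)%:R * v c)) (bigD1 j)//= eqxx mul1r.
  rewrite big1 ?addr0 => [|c]; last by rewrite eq_sym => /negbTE ->; rewrite mul0r.
  by case: eqP => [->|]; rewrite ?mulr0 ?mul0r.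
have rk t : (\rank (M X + t *: B)%R <= \rank (M X))%N.
  by rewrite MB; exact: (generic_rank _ b gen).
have /matrixP/(_ 0 0) := rank_tangent rk uM Mw.
rewrite [RHS]mxE => <-.
have -> : (u *m B *m w) 0 0 = \sum_c (u *m B) 0 c * v (enum_val c).
  by rewrite mxE; apply: eq_bigr => c _; rewrite [w _ _]mxE.
rewrite /dot -(sum_enum_val (fun j => flow k Y j * v j)).
apply: eq_bigr => c _; congr (_ * _); rewrite fE mxE.
pose F (r : constraint S) := match r with
  | inl x => kx x * ((b r)%:R * constraint_mx Y (enum_rank r) c) | inr j => 0 end.
transitivity (\sum_(r < #|constraint S|) F (enum_val r)).
  rewrite sum_enum_val big_sumType /F /= [X in _ + X]big1 ?addr0 //; apply: eq_bigr => x _.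
  by rewrite constraint_mx_inl [RHS]mulrA kxb.
apply: eq_bigr => r _; rewrite [u _ _]mxE [B _ _]mxE /F enum_valK.
by case: (enum_val r) => // j; rewrite mulr0.
Qed.

(** For payoffs concentrated on one player and one profile, [generic_tangent] is the balance
    equation at that profile. *)
Lemma generic_stationary X (k : rates S R) v : generic_payoff X ->
  (forall i a b, k i a b != 0 -> dev X a b v = 0) ->
  (forall j, v j != 0 -> flow k X j = 0) ->
  forall i, stationary_in k i v.
Proof.
move=> gen kv vk i j0.
pose Y i' j : R := ((i' == i) && (j == j0))%:R.
have := generic_tangent Y gen kv vk; rewrite flow_dev.
rewrite (bigD1 i)//= [X in _ + X]big1 ?addr0; last first.
  move=> i' /negbTE ne; apply: big1 => a _; apply: big1 => b _.
  by rewrite /dev /dot /coef /Y ne big1 ?mulr0// => j _; rewrite subrr mulr0 mul0r.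
have E a b : dev Y a b v = (j0 i == a)%:R * v j0 - (j0 i == b)%:R * v (upd j0 a).
  rewrite /dev /dot /coef /Y eqxx /=.
  under eq_bigr do rewrite mulrBr mulrBl.
  rewrite sumrB (bigD1 j0)//= eqxx mulr1 [X in _ + X - _]big1 ?addr0; last first.
    by move=> j /negbTE ->; rewrite mulr0 mul0r.
  congr (_ - _); rewrite (bigD1 (upd j0 a))//= updE eqxx mul1r updK.
  rewrite [X in _ + X]big1 ?addr0 => [|j jN].
    congr ((nat_of_bool _)%:R * _); apply/eqP/eqP => [<-|<-]; last by rewrite upd_id.
    by rewrite updE.
  case: eqP => [ja|]; last by rewrite !mul0r.
  case: eqP => [jb|]; last by rewrite mulr0 mul0r.
  by case/eqP: jN; rewrite -jb updK -ja upd_id.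
under eq_bigr do under eq_bigr do rewrite E mulrBr.
under eq_bigr do rewrite sumrB.
rewrite sumrB => /eqP; rewrite subr_eq0 => /eqP H.
rewrite mulr_suml.
transitivity (\sum_a \sum_b k i a b * ((j0 i == a)%:R * v j0)).
  rewrite [RHS](bigD1 (j0 i))//= [X in _ + X]big1 ?addr0 ?eqxx.
    by apply: eq_bigr => b _; rewrite mul1r.
  by move=> a; rewrite eq_sym => /negbTE ->; apply: big1 => b _; rewrite mul0r mulr0.
rewrite H; apply: eq_bigr => a _.
rewrite (bigD1 (j0 i))//= eqxx mul1r big1 ?addr0// => b.
by rewrite eq_sym => /negbTE ->; rewrite mul0r mulr0.
Qed.

End GenericTangent.

(** * Complementary weights and stationarity *)

Section Stationarity.
Variables (n : nat) (S : 'I_n -> finType) (R : realType) (k : rates S R).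
Arguments k : clear implicits.
Implicit Types (v Z : profile S -> R) (j : profile S).

Lemma reindex_upd i (a b : S i) (F : profile S -> R) :
  \sum_(j : profile S | j i == a) F j = \sum_(j : profile S | j i == b) F (upd j a).
Proof.
rewrite (reindex_onto (fun j => upd j a) (fun j => upd j b)) => [|j /eqP <-].
  apply: eq_bigl => j; rewrite updE eqxx /= updK.
  by apply/eqP/eqP => [<-|<-]; rewrite ?updE ?upd_id.
by rewrite updK upd_id.
Qed.

(** The generator of a chain integrates to zero against a stationary measure; the involution [h]
    reverses jumps. *)
Lemma stationary_in_sum i Z v : stationary_in k i v ->
  \sum_j v j * \sum_l k i (j i) l * (Z j - Z (upd j l)) = 0.
Proof.
move=> vi.
have E1 : \sum_j \sum_l v j * k i (j i) l * Z (upd j l) =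
          \sum_(j : profile S) \sum_m k i m (j i) * v (upd j m) * Z j.
  rewrite !pair_big /=.
  pose h (x : profile S * S i) := (upd x.1 x.2, x.1 i).
  have hK : involutive h by move=> [j a]; rewrite /h /= updK upd_id updE.
  rewrite [RHS](reindex h) /=; last by exists h => x _; rewrite hK.
  by apply: eq_bigr => -[j a] _ /=; rewrite updE updK upd_id [k _ _ _ * _]mulrC.
transitivity (\sum_(j : profile S) \sum_l v j * k i (j i) l * Z j -
              \sum_(j : profile S) \sum_l v j * k i (j i) l * Z (upd j l)).
  rewrite -sumrB; apply: eq_bigr => j _; rewrite -sumrB mulr_sumr.
  by apply: eq_bigr => l _; ring.
rewrite E1 -sumrB; apply: big1 => j _.
by rewrite -!mulr_suml -mulr_sumr -vi [v j * _]mulrC subrr.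
Qed.

Lemma stationary_in_line i v j : stationary_in k i v ->
  stationary1 (k i) (fun a => v (upd j a)).
Proof.
move=> vi a; have := vi (upd j a); rewrite updE => ->.
by apply: eq_bigr => m _; rewrite updK.
Qed.

Lemma stationary_in_marginal i v : stationary_in k i v ->
  stationary1 (k i) (fun a => \sum_(j : profile S | j i == a) v j).
Proof.
move=> vi a /=; rewrite mulr_sumr.
transitivity (\sum_(j : profile S | j i == a) \sum_m k i m a * v (upd j m)).
  by apply: eq_bigr => j /eqP <-; rewrite vi.
rewrite exchange_big; apply: eq_bigr => m _ /=.
by rewrite -mulr_sumr (reindex_upd m a).
Qed.

Lemma stationary_in_prod (w : forall i, S i -> R) i :
  (forall i, stationary1 (k i) (w i)) ->
  stationary_in k i (fun j => \prod_i w i (j i)).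
Proof.
move=> ws j /=; rewrite (bigD1 i)//= mulrA ws mulr_suml.
apply: eq_bigr => m _; rewrite [X in _ = _ * X](bigD1 i)//= updE mulrA.
by congr (_ * _); apply: eq_bigr => i' ne; rewrite updNE.
Qed.

End Stationarity.

(** * Strictly complementary weights and the product structure of the support *)

Section Complementarity.
Variables (n : nat) (S : 'I_n -> finType) (R : realType).
Variable X : 'I_n -> profile S -> R.
Implicit Types (v : profile S -> R) (j : profile S).

(** The cone over the polytope: without normalization the constraints are homogeneous, as strict
    complementarity requires. *)
Definition in_cone v : Prop :=
  (forall j, 0 <= v j) /\ (forall i (a b : S i), 0 <= dev X a b v).

Record complementary (k : rates S R) (mu p : profile S -> R) : Prop := {
  compl_rates_ge0 : forall i a b, 0 <= k i a b;
  compl_mu_ge0 : forall j, 0 <= mu j;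
  compl_flow : forall j, flow k X j + mu j = 0;
  compl_cone : in_cone p;
  compl_dev : forall i a b, 0 < k i a b + dev X a b p;
  compl_coord : forall j, 0 < mu j + p j }.

Lemma complementary_exists : exists k mu p, complementary k mu p.
Proof.
(* Diagonal pairs are included; their rows are zero, so the diagonal rates become positive. *)
pose I := ({i : 'I_n & (S i * S i)%type} + profile S)%type.
pose A (r : I) (j : profile S) : R := match r with
  | inl x => coef X (tagged x).1 (tagged x).2 j | inr j' => (j' == j)%:R end.
have [y [p [y0 yA Ap yp]]] := strict_complementarity A.
have dA j : dot (A (inr j)) p = p j.
  rewrite /dot (bigD1 j)//= eqxx mul1r big1 ?addr0// => j' /negbTE.
  by rewrite eq_sym => ->; rewrite mul0r.
exists (fun i a b => y (inl (existT _ i (a, b)))), (fun j => y (inr j)), p.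
split=> //.
- move=> j; rewrite -(yA j) big_sumType /= flow_coef sum_tag; congr (_ + _).
    by apply: eq_bigr => -[i [a b]] _.
  rewrite (bigD1 j)//= eqxx mulr1 big1 ?addr0// => j' /negbTE ->.
  by rewrite mulr0.
- split=> [j|i a b]; first by rewrite -dA.
  exact: (Ap (inl (existT _ i (a, b)))).
- by move=> j; have := yp (inr j); rewrite dA.
Qed.

Variables (k : rates S R) (mu p : profile S -> R).
Arguments k : clear implicits.
Hypothesis C : complementary k mu p.

Let k_ge0 := compl_rates_ge0 C.

Lemma compl_ge0 j : 0 <= p j. Proof. by have [+ _] := compl_cone C; apply. Qed.

(** Pairing the relation [compl_flow] with [v] gives a vanishing sum of nonnegative terms. *)
Lemma cone_pairing v : in_cone v ->
  (forall i a b, k i a b * dev X a b v = 0) /\ (forall j, mu j * v j = 0).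
Proof.
move=> [v0 dv]; have kd0 i a b : 0 <= k i a b * dev X a b v by rewrite mulr_ge0.
have mv0 j : 0 <= mu j * v j by rewrite mulr_ge0 ?(compl_mu_ge0 C).
have H : \sum_i \sum_a \sum_b k i a b * dev X a b v + \sum_j mu j * v j = 0.
  rewrite -flow_dev -big_split big1// => j _ /=.
  by rewrite -mulrDl (compl_flow C) mul0r.
have s1 i a : 0 <= \sum_b k i a b * dev X a b v by apply: sumr_ge0.
have s2 i : 0 <= \sum_a \sum_b k i a b * dev X a b v by apply: sumr_ge0.
move/eqP: H; rewrite paddr_eq0 ?sumr_ge0// => /andP[/eqP H1 /eqP H2].
split; last exact: psum_eq0 H2.
move=> i a; apply: psum_eq0 => //.
by move: a; apply: psum_eq0 => //; move: i; exact: psum_eq0 H1.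
Qed.

Lemma cone_supp v j : in_cone v -> p j = 0 -> v j = 0.
Proof.
move=> /cone_pairing[_ /(_ j)/eqP]; have := compl_coord C j => + + pj.
by rewrite pj addr0 mulf_eq0 => mj; rewrite gt_eqF//= => /eqP.
Qed.

Lemma cone_dev v i a b : in_cone v -> 0 < k i a b -> dev X a b v = 0.
Proof.
move=> /cone_pairing[/(_ i a b)/eqP + _] kab.
by rewrite mulf_eq0 gt_eqF//= => /eqP.
Qed.

Lemma mu_eq0 j : p j != 0 -> mu j = 0.
Proof.
have [_ /(_ j)/eqP] := cone_pairing (compl_cone C).
by rewrite mulf_eq0 => /orP[/eqP//|->].
Qed.

Lemma flow_eq0 j : p j != 0 -> flow k X j = 0.
Proof. by move=> /mu_eq0 mj; have := compl_flow C j; rewrite mj addr0. Qed.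

(* Hart and Schmeidler's argument: the product of stationary measures is
   orthogonal to the flow, hence to [mu]. *)
Lemma prod_stationary_supp (w : forall i, S i -> R) j :
  (forall i, stationary1 (k i) (w i)) -> (forall i a, 0 <= w i a) ->
  (forall i, w i (j i) != 0) -> p j != 0.
Proof.
move=> ws w0 wj; pose v j := \prod_i w i (j i).
have v0 j' : 0 <= v j' by apply: prodr_ge0.
have vmu0 j' : 0 <= v j' * mu j' by rewrite mulr_ge0 ?(compl_mu_ge0 C).
have : \sum_j v j * mu j = 0.
  transitivity (- \sum_j v j * flow k X j).
    rewrite -sumrN; apply: eq_bigr => j' _; rewrite -mulrN; congr (_ * _).
    by apply/eqP; rewrite -addr_eq0 addrC (compl_flow C).
  rewrite /flow; under eq_bigr do rewrite mulr_sumr.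
  rewrite exchange_big big1 ?oppr0// => i _ /=.
  by apply: stationary_in_sum; exact: stationary_in_prod.
move/(psum_eq0 vmu0)/(_ j)/eqP; rewrite mulf_eq0 => /orP[|/eqP mj].
  by move/prodf_eq0 => [i _]; rewrite (negbTE (wj i)).
by have := compl_coord C j; rewrite mj add0r lt0r => /andP[].
Qed.

Lemma compl_neq0 : (forall i, S i) -> exists j, p j != 0.
Proof.
move=> s; pose w i := cid (stationary1_exists (@k_ge0 i) (s i)).
have wP i : exists a, 0 < sval (w i) a by have [] := svalP (w i).
exists [ffun i => sval (cid (wP i))].
apply: (prod_stationary_supp (w := fun i => sval (w i))) => i.
- by have [] := svalP (w i).
- by have [] := svalP (w i).
- by rewrite ffunE gt_eqF//; exact: svalP (cid (wP i)).
Qed.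

Hypothesis gen : generic_payoff X.

(** A description without payoffs of the tensors supported where [p] is and killed by all incentive
    rows of positive rate: [dev0_harmonious] and [harmonious_dev] are the two inclusions. *)
Definition harmonious v : Prop :=
  (forall j, p j = 0 -> v j = 0) /\ (forall i, stationary_in k i v).

Lemma dev0_harmonious v : (forall j, p j = 0 -> v j = 0) ->
  (forall i a b, 0 < k i a b -> dev X a b v = 0) -> harmonious v.
Proof.
move=> supp dv; split=> //; apply: generic_stationary gen _ _.
  by move=> i a b kab; apply: dv; rewrite lt0r kab k_ge0.
move=> j vj; apply: flow_eq0; apply: contraNN vj => /eqP/supp ->.
by rewrite eqxx.
Qed.

Lemma cone_harmonious v : in_cone v -> harmonious v.
Proof.
by move=> vc; apply: dev0_harmonious => *; [exact: cone_supp|exact: cone_dev].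
Qed.

Definition active i (a : S i) : bool := [exists j : profile S, (j i == a) && (p j != 0)].

(** The marginals of [p] are stationary, so [prod_stationary_supp] applies to their product and the
    support is a product set. *)
Lemma active_supp j : (forall i, active (j i)) <-> p j != 0.
Proof.
split=> [act|pj i]; last by apply/existsP; exists j; rewrite eqxx.
have [_ pst] := cone_harmonious (compl_cone C).
apply: (@prod_stationary_supp (fun i a => \sum_(j : profile S | j i == a) p j)).
- by move=> i; exact: stationary_in_marginal.
- by move=> i a; apply: sumr_ge0 => j' _; exact: compl_ge0.
- move=> i; have /existsP[j' /andP[ji pj']] := act i.
  rewrite psumr_neq0 => [|? _]; last exact: compl_ge0.
  by apply/hasP; exists j'; rewrite ?mem_index_enum// ji lt0r pj' compl_ge0.
Qed.

Lemma active_upd j i (a : S i) : p j != 0 -> active a -> p (upd j a) != 0.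
Proof.
move=> /active_supp jp act; apply/active_supp => i'.
have [->|ne] := eqVneq i' i; first by rewrite updE.
by rewrite updNE.
Qed.

(** The payoffs [x] of the strategies of player [i] against the slice of [v] at [a] form a harmonic
    function, hence are constant along edges. *)
Lemma harmonious_dev v i a b : harmonious v -> 0 < k i a b -> dev X a b v = 0.
Proof.
move=> [supp vst] kab.
have devE c : \sum_(j : profile S | j i == a)
    (X i (upd j a) - X i (upd j c)) * v j = dev X a c v.
  rewrite /dev /dot big_mkcond; apply: eq_bigr => j _; rewrite /coef.
  by case: eqP => [<-|]; rewrite ?upd_id ?mul1r ?mul0r.
case: (boolP (active a)) => [act|nact]; last first.
  rewrite -devE; apply: big1 => j ja; rewrite (supp j) ?mulr0//.
  apply/eqP; apply: contraNT nact => pj; apply/existsP; exists j.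
  by rewrite ja.
pose x (c : S i) := \sum_(j : profile S | j i == a) X i (upd j c) * v j.
rewrite -devE; under eq_bigr do rewrite mulrBl.
rewrite sumrB; apply/eqP; rewrite subr_eq0; apply/eqP.
rewrite -/(x a) -/(x b).
pose rho (c : S i) := \sum_(j : profile S | j i == c) p j.
have rho_st : stationary1 (k i) rho.
  by apply: stationary_in_marginal; have [_] := cone_harmonious (compl_cone C).
have rho0 c : (rho c != 0) = active c.
  rewrite psumr_neq0 => [|? _]; last exact: compl_ge0.
  apply/hasP/existsP => [[j _ /andP[jc pj]]|[j /andP[jc pj]]].
    by exists j; rewrite jc gt_eqF.
  by exists j; rewrite ?mem_index_enum// jc lt0r pj compl_ge0.
apply: (harmonic_edge (@k_ge0 i) _ rho_st _ kab).
- by move=> c; apply: sumr_ge0 => j _; exact: compl_ge0.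
- move=> c; rewrite rho0 => cact.
  (* The slice of [v] at [a], transplanted to [c]. It is stationary for the other players and lives
     where the flow vanishes, so only player [i] contributes. *)
  pose z j := (j i == c)%:R * v (upd j a).
  have : \sum_j z j * flow k X j = 0.
    apply: big1 => j _; rewrite /z; case: eqP => [jc|]; last by rewrite !mul0r.
    have [->|vj] := eqVneq (v (upd j a)) 0; first by rewrite mulr0 mul0r.
    rewrite flow_eq0 ?mulr0// -(upd_id j i) -(updK j a) jc.
    apply: active_upd => //; apply: contraNN vj => /eqP/supp ->.
    by rewrite eqxx.
  rewrite /flow; under eq_bigr do rewrite mulr_sumr.
  rewrite exchange_big (bigD1 i)//= [X in _ + X]big1 ?addr0 => [H|i' ne]; last first.
    apply: stationary_in_sum => j; rewrite /z mulrCA.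
    have := vst i' (upd j a); rewrite updNE// => ->; rewrite mulr_sumr.
    apply: eq_bigr => m _; rewrite mulrCA; congr (_ * _).
    by rewrite updNE 1?eq_sym// updC 1?eq_sym.
  rewrite -[RHS]H; transitivity (\sum_(j : profile S | j i == c)
      v (upd j a) * \sum_l k i c l * (X i j - X i (upd j l))).
    rewrite (reindex_upd c a); under [RHS]eq_bigr do rewrite mulr_sumr.
    rewrite exchange_big; apply: eq_bigr => l _ /=.
    rewrite /x -sumrB mulr_sumr; apply: eq_bigr => j /eqP ja.
    have -> : upd (upd j c) a = j by rewrite updK -ja upd_id.
    by rewrite updK; ring.
  rewrite big_mkcond; apply: eq_bigr => j _; rewrite /z.
  by case: eqP => [->|]; rewrite ?mul1r ?mul0r.
- by rewrite rho0.
Qed.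

End Complementarity.

(** * Rigidity *)

Section Rigidity.
Variables (n : nat) (S : 'I_n -> finType) (R : realType).
Variable X : 'I_n -> profile S -> R.
Implicit Types (v : profile S -> R) (j : profile S).
Variables (k : rates S R) (mu p : profile S -> R).
Arguments k : clear implicits.
Hypothesis C : complementary X k mu p.
Hypothesis gen : generic_payoff X.

Let k_ge0 i a b : 0 <= k i a b := compl_rates_ge0 C a b.
Let p_stat : forall i, stationary_in k i p.
Proof. by have [] := cone_harmonious C gen (compl_cone C). Qed.

Definition constant_on_edges i (phi : S i -> R) : Prop :=
  forall a b, active p a -> 0 < k i a b -> phi a = phi b.

(** Tested on real functions instead of paths, since functions can multiply tensors as in
    [harmonious_mul]. *)
Definition connected i : Prop := forall phi : S i -> R,
  constant_on_edges phi -> forall a b, active p a -> active p b -> phi a = phi b.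

Lemma supp_active j i : p j != 0 -> active p (j i).
Proof. by move/(active_supp C gen). Qed.

(** The factor agrees at both ends of every jump carrying mass, so it passes through the balance
    equations. *)
Lemma harmonious_mul i (phi : S i -> R) v :
  constant_on_edges phi -> harmonious k p v ->
  harmonious k p (fun j => phi (j i) * v j).
Proof.
move=> phiE [supp vst]; split=> [j /supp ->|i' j]; first by rewrite mulr0.
have [E|ne] := eqVneq i' i; last first.
  rewrite mulrCA vst mulr_sumr; apply: eq_bigr => m _.
  by rewrite updNE 1?eq_sym// mulrCA.
subst i'; rewrite mulrCA vst mulr_sumr; apply: eq_bigr => m _.
rewrite updE; have [->|km] := eqVneq (k i m (j i)) 0; first by rewrite !mul0r mulr0.
have [->|vj] := eqVneq (v (upd j m)) 0; first by rewrite !mulr0.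
rewrite mulrCA; congr (_ * (_ * _)); apply/esym/phiE; last by rewrite lt0r km k_ge0.
have := @supp_active (upd j m) i; rewrite updE; apply.
by apply: contraNN vj => /eqP/supp ->; rewrite eqxx.
Qed.

(* If [phi] separates two recurrent classes of player [i'], then cutting the
   row of the tight deviation (a, b) along a level set of [phi] stays in the
   row span of the tight constraints; the resulting relations would make a
   single edge from [a] to [b] a circulation. *)
Lemma connected_others i (a b : S i) i' :
  a != b -> active p a -> 0 < k i a b -> i' != i -> connected i'.
Proof.
move=> ab acta kab ne phi phiE m0 m1 act0 act1.
pose I := ({i : 'I_n & (S i * S i)%type} + profile S)%type.
pose A (r : I) (j : profile S) : R := match r with
  | inl x => (0 < k _ (tagged x).1 (tagged x).2)%R%:R * coef X (tagged x).1 (tagged x).2 j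
  | inr j' => (p j' == 0)%:R * (j' == j)%:R end.
(* A vector killed by the tight rows is harmonious, and so is its product with [phi]; hence the cut
   row kills it, and by duality is a combination of tight rows. *)
have [q Aq|y yE] := @bipolar_span _ _ _ A (fun j => phi (j i') * coef X a b j).
  have qh : harmonious k p q.
    apply: (dev0_harmonious C gen) => [j pj|i1 a1 b1 k1].
      have := Aq (inr j); rewrite /dot /A (bigD1 j)//= pj !eqxx !mul1r big1 ?addr0//.
      by move=> j'; rewrite eq_sym => /negbTE ->; rewrite mulr0 mul0r.
    rewrite -(Aq (inl (existT _ i1 (a1, b1)))) /dev /dot; apply: eq_bigr => j _.
    by rewrite /A /= k1 mul1r.
  rewrite -(harmonious_dev C gen (harmonious_mul phiE qh) kab).
  by apply: eq_bigr => j _; rewrite -[LHS]mulrA [RHS]mulrCA.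
pose kap : rates S R := fun i1 a1 b1 =>
  (0 < k i1 a1 b1)%R%:R * y (inl (existT _ i1 (a1, b1))).
have kapE j : p j != 0 -> flow kap X j = phi (j i') * coef X a b j.
  move=> /negbTE pj; rewrite yE big_sumType /= [X in _ + X]big1 ?addr0; last first.
    move=> j' _; case: (eqVneq j' j) => [->|_]; rewrite ?pj ?mul0r !mulr0 //.
  rewrite flow_coef sum_tag; apply: eq_bigr => -[i1 [a1 b1]] _ /=.
  by rewrite /kap mulrAC mulrC mulrA.
pose T1 i1 (a1 b1 : S i1) : {i : 'I_n & (S i * S i)%type} := existT _ i1 (a1, b1).
(* Lowering the weight of the edge from [a] to [b] by [c] makes the flow vanish on the part of the
   support where [phi] equals [c]. *)
pose kap' c : rates S R := fun i1 a1 b1 =>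
  kap i1 a1 b1 - c * (T1 i1 a1 b1 == T1 i a b)%:R.
have kap'E c j : flow (kap' c) X j = flow kap X j - c * coef X a b j.
  rewrite !flow_coef !sum_tag (bigD1 (T1 i a b))//= [in RHS](bigD1 (T1 i a b))//=.
  rewrite /kap' eqxx mulr1 mulrBl addrAC; congr (_ + _ - _).
  apply: eq_bigr => -[i1 [a1 b1]] /negbTE E; rewrite /= -/(T1 i1 a1 b1) in E *.
  by rewrite E mulr0 subr0.
(* The edge from [a] to [b] leaves [a], so the correction enters the outflow at [a] but not the
   inflow. *)
have balance j : j i = a -> p j != 0 ->
  (\sum_l kap i a l - phi (j i')) * p j = \sum_m kap i m a * p (upd j m).
  move=> ja pj; set c := phi (j i').
  pose v j := (phi (j i') == c)%:R * p j.
  have vh : harmonious k p v.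
    apply: (@harmonious_mul i' (fun d => (phi d == c)%:R) p).
      by move=> d e actd kde; rewrite (phiE d e).
    exact: (cone_harmonious C gen (compl_cone C)).
  have := @generic_stationary _ _ _ X (kap' c) v gen.
  have h1 i1 (a1 b1 : S i1) : kap' c i1 a1 b1 != 0 -> dev X a1 b1 v = 0.
    move=> kN; apply: (harmonious_dev C gen vh); apply: contraNT kN.
    rewrite /kap' /kap; case: (eqVneq (T1 i1 a1 b1) (T1 i a b)) => [E|_].
      move=> kN; exfalso; move: kN.
      have -> : k i1 a1 b1 = k _ (tagged (T1 i1 a1 b1)).1 (tagged (T1 i1 a1 b1)).2 by [].
      by rewrite E /= kab.
    by move=> /negbTE ->; rewrite mul0r mulr0 subrr.
  have h2 j1 : v j1 != 0 -> flow (kap' c) X j1 = 0.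
    rewrite /v; have [E|_] := eqVneq (phi (j1 i')) c; last by rewrite mul0r eqxx.
    by rewrite mul1r => pj1; rewrite kap'E kapE// E subrr.
  move=> /(_ h1 h2 i j); rewrite ja /v eqxx mul1r => H.
  transitivity ((\sum_l kap' c i a l) * p j).
    congr (_ * _); rewrite sumrB; congr (_ - _).
    rewrite (bigD1 b)//= eqxx mulr1 big1 ?addr0// => l lb.
    by rewrite eq_Tagged /= xpair_eqE (negbTE lb) andbF mulr0.
  rewrite H; apply: eq_bigr => m _; rewrite updNE// eqxx mul1r; congr (_ * _).
  by rewrite /kap' eq_Tagged /= xpair_eqE (negbTE ab) andbF mulr0 subr0.
have [j0 /andP[/eqP j0a pj0]] := existsP acta.
pose j := upd j0 m0; pose j' := upd j0 m1.
have pj : p j != 0 by apply: (active_upd C gen).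
have pj' : p j' != 0 by apply: (active_upd C gen).
have ja : j i = a by rewrite updNE// eq_sym.
have j'a : j' i = a by rewrite updNE// eq_sym.
have := balance j ja pj; have := balance j' j'a pj'.
rewrite !updE => B' B.
(* The lines of [p] through [j] and [j'] have equal ratios along each edge into [a], so the inflows
   are proportional; the outflows then force equal values of [phi]. *)
have E : (\sum_m kap i m a * p (upd j m)) * p j' =
         (\sum_m kap i m a * p (upd j' m)) * p j.
  rewrite !mulr_suml; apply: eq_bigr => m _.
  rewrite /kap; case: ltP => [kma|_]; last by rewrite !mul0r.
  rewrite mul1r -!mulrA; congr (_ * _).
  have ua : upd j a = j by rewrite -ja upd_id.
  have ua' : upd j' a = j' by rewrite -j'a upd_id.
  have /= := stationary1_ratio (@k_ge0 i) (fun d => compl_ge0 C (upd j d))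
    (stationary_in_line j (p_stat i)) (stationary_in_line j' (p_stat i)) _ kma.
  rewrite ua ua' => -> //; first by rewrite mulrC.
  move=> d; apply: contraPP => /eqP pd; apply/eqP.
  have -> : upd j d = upd (upd j' d) m0 by rewrite (updC j0 m0 d)// (updC j0 m1 d)// updK.
  exact: (active_upd C gen).
have : (phi m0 - phi m1) * (p j * p j') = 0.
  have : (\sum_l kap i a l - phi m0) * p j * p j' =
         (\sum_l kap i a l - phi m1) * p j' * p j.
    by rewrite B B' E.
  move=> H; apply/eqP; rewrite -subr_eq0 subr0; apply/eqP.
  apply: (@addrI _ ((\sum_l kap i a l - phi m0) * p j * p j')); rewrite addr0 {2}H; ring.
by move/eqP; rewrite !mulf_eq0 (negbTE pj) (negbTE pj') !orbF subr_eq0 => /eqP.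
Qed.

(** In a product support the coordinates of [j] can be replaced by those of [j'] one player at a
    time. *)
Lemma supp_walk (A : pred 'I_n) (f : profile S -> R) :
  (forall j i (a : S i), A i -> p j != 0 -> active p a -> f (upd j a) = f j) ->
  forall j j', p j != 0 -> p j' != 0 -> (forall i, ~~ A i -> j i = j' i) ->
  f j = f j'.
Proof.
move=> fA j j' pj pj' jj'.
pose mix m : profile S := [ffun i : 'I_n => if (i < m)%N then j' i else j i].
have pmix m : p (mix m) != 0.
  apply/(active_supp C gen) => i; rewrite ffunE.
  by case: ifP => _; exact: supp_active.
have fmix m : (m <= n)%N -> f (mix m) = f j.
  elim: m => [_|m IH mn].
    by congr f; apply: profileP => i; rewrite ffunE.
  rewrite -IH ?(ltnW mn)//; pose i := Ordinal mn.
  have -> : mix m.+1 = upd (mix m) (j' i).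
    apply: profileP => i'; have [->|ne] := eqVneq i' i.
      by rewrite updE ffunE ltnSn.
    rewrite updNE// !ffunE ltnS leq_eqVlt; case: eqP => // E.
    by case/eqP: ne; apply: val_inj.
  case: (boolP (A i)) => [Ai|nAi]; first by apply: fA => //; exact: supp_active.
  by rewrite -(jj' _ nAi); congr f; rewrite -[RHS](upd_id (mix m) i) ffunE /= ltnn.
rewrite -(fmix n)//; congr f; apply: profileP => i.
by rewrite ffunE ltn_ord.
Qed.

Lemma active_edge i (a b : S i) : active p a -> 0 < k i a b -> active p b.
Proof.
move=> /existsP[j /andP[/eqP ja pj]] kab; apply/existsP; exists (upd j b).
rewrite updE eqxx /=; apply: contraTneq kab => p0.
have := p_stat i (upd j b); rewrite p0 mulr0 updE => /esym.
move/psum_eq0 => /(_ _ a); rewrite updK -ja upd_id => H.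
rewrite -leNgt; have /eqP : k i (j i) b * p j = 0.
  by apply: H => m; rewrite mulr_ge0 ?k_ge0 ?(compl_ge0 C).
by rewrite mulf_eq0 (negbTE pj) orbF => /eqP ->.
Qed.

(** Stationary measures on a line have the same ratio at both ends of an edge; connectedness spreads
    it over the line. *)
Lemma connected_ratio i v j (a : S i) : connected i ->
  stationary_in k i v -> (forall j, p j = 0 -> v j = 0) ->
  p j != 0 -> active p a -> v (upd j a) / p (upd j a) = v j / p j.
Proof.
move=> conn vst supp pj acta.
rewrite -[in RHS](upd_id j i).
apply: (conn (fun c => v (upd j c) / p (upd j c))) => //; last exact: supp_active.
move=> c d actc kcd; have actd := active_edge actc kcd.
have pc : p (upd j c) != 0 by apply: (active_upd C gen).
have pd : p (upd j d) != 0 by apply: (active_upd C gen).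
apply/eqP; rewrite eqr_div//; apply/eqP.
have := stationary1_ratio (@k_ge0 i) (fun d => compl_ge0 C (upd j d))
  (stationary_in_line j (p_stat i)) (stationary_in_line j vst) (fun d => supp (upd j d)) kcd.
by move=> H; rewrite mulrC -H mulrC.
Qed.

(** Slices of [p] in direction [i] are proportional, so the incentives from [a] to [b] and back have
    opposite signs. Both are nonnegative, hence zero, and complementarity puts an edge between any
    two active strategies. *)
Lemma connected_of_others i : (forall i', i' != i -> connected i') -> connected i.
Proof.
move=> conn; suff act_k (a b : S i) : active p a -> active p b -> 0 < k i a b.
  by move=> phi phiE a b acta actb; apply: phiE => //; exact: act_k.
move=> acta actb; have [j0 /andP[/eqP j0a pj0]] := existsP acta.
(* The slice of [p] at [b], copied over every active strategy of player [i]; its ratio to [p] on the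
   slice at [a] is the constant [g]. *)
pose z j := (active p (j i))%:R * p (upd j b).
have zst i' : i' != i -> stationary_in k i' z.
  move=> ne j; rewrite /z mulrCA; have := p_stat i' (upd j b).
  rewrite updNE// => ->; rewrite mulr_sumr; apply: eq_bigr => m _.
  by rewrite mulrCA updNE 1?eq_sym// updC 1?eq_sym.
have zsupp j : p j = 0 -> z j = 0.
  move=> pj; rewrite /z; case: (boolP (active p (j i))) => [actj|]; last by rewrite mul0r.
  rewrite mul1r; apply/eqP; apply: contraPT pj => pb; apply/eqP.
  by rewrite -(upd_id j i) -(updK j b); apply: (active_upd C gen).
pose g := z j0 / p j0.
have zg j : j i = a -> p (upd j b) = g * p j.
  move=> ja; have [pj|pj] := eqVneq (p j) 0.
    by have := zsupp j pj; rewrite /z ja acta mul1r pj mulr0.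
  rewrite /g (@supp_walk (fun i' => i' != i) (fun j => z j / p j) _ j0 j)//.
  - by rewrite divfK// /z ja acta mul1r.
  - move=> j1 i' c ne pj1 actc; apply: connected_ratio => //; [exact: conn|exact: zst].
  - by move=> i' /negPn/eqP E; subst i'; rewrite ja.
have g0 : 0 < g.
  rewrite /g /z j0a acta mul1r divr_gt0// lt0r (compl_ge0 C) andbT//.
  exact: (active_upd C gen).
have dba : dev X b a p = - g * dev X a b p.
  have devE c d : dev X c d p = \sum_(j : profile S | j i == c) (X i j - X i (upd j d)) * p j.
    rewrite [RHS]big_mkcond; apply: eq_bigr => j _; rewrite /coef.
    by case: eqP => _; rewrite ?mul1r ?mul0r.
  rewrite !devE (reindex_upd b a) mulr_sumr; apply: eq_bigr => j /eqP ja.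
  rewrite zg// updK; have -> : upd j a = j by rewrite -ja upd_id.
  ring.
have [_ dp] := compl_cone C.
have d0 : dev X a b p = 0.
  apply: le_anti; rewrite (dp _ a b) andbT.
  by have := dp _ b a; rewrite dba mulNr oppr_ge0 pmulr_rle0.
by have := compl_dev C a b; rewrite d0 addr0.
Qed.

Lemma rigid i (a b : S i) : a != b -> active p a -> 0 < k i a b ->
  forall v, harmonious k p v -> exists c, forall j, v j = c * p j.
Proof.
move=> ab acta kab v [supp vst].
have others i' : i' != i -> connected i' by exact: connected_others ab acta kab.
have conn i' : connected i'.
  have [->|] := eqVneq i' i; last exact: others.
  exact: connected_of_others.
have [j0 /andP[_ pj0]] := existsP acta.
exists (v j0 / p j0) => j; have [pj|pj] := eqVneq (p j) 0.
  by rewrite pj supp// mulr0.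
rewrite (@supp_walk xpredT (fun j => v j / p j) _ j0 j) ?divfK//.
by move=> j1 i' c _ pj1 actc; exact: connected_ratio.
Qed.

End Rigidity.

(** * Inactive strategies and full-dimensional polytopes *)

Section NeverBestResponse.
Variables (n : nat) (S : 'I_n -> finType) (R : realType).
Variable X : 'I_n -> profile S -> R.
Implicit Types (v : profile S -> R) (j : profile S).
Variables (k : rates S R) (mu p : profile S -> R).
Hypothesis C : complementary X k mu p.
Hypothesis strict : forall i (a b : S i), a != b -> active p a -> 0 < dev X a b p.

Lemma dev_inactive i (a b : S i) v : (forall j, p j = 0 -> v j = 0) ->
  ~~ active p a -> dev X a b v = 0.
Proof.
move=> supp nact; apply: big1 => j _; rewrite /coef.
case: eqP => [ja|]; last by rewrite !mul0r.
rewrite supp ?mulr0//; apply/eqP; apply: contraNT nact => pj.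
by apply/existsP; exists j; rewrite ja eqxx.
Qed.

(* If some deviation to [b] were profitable against [v], a best response to the
   conditional distribution of [v] given [a] would be inactive; moving a little
   mass there keeps [p] in the cone and enlarges its support. *)
Lemma restricted_cone v : (forall j, 0 <= v j) ->
  (forall j, p j = 0 -> v j = 0) ->
  (forall i (a b : S i), active p a -> active p b -> 0 <= dev X a b v) ->
  in_cone X v.
Proof.
move=> v0 supp act_dev; split=> // i a b.
case: (boolP (active p a)) => [acta|nacta]; last by rewrite dev_inactive.
pose x (c : S i) := \sum_(j : profile S | j i == a) X i (upd j c) * v j.
have devE c d (w : profile S -> R) :
    dev X c d w = \sum_(j : profile S | j i == c) (X i (upd j c) - X i (upd j d)) * w j.
  rewrite /dev /dot [RHS]big_mkcond; apply: eq_bigr => j _; rewrite /coef.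
  by case: eqP => [<-|]; rewrite ?upd_id ?mul1r ?mul0r.
have devx c : dev X a c v = x a - x c.
  by rewrite devE /x -sumrB; apply: eq_bigr => j _; rewrite mulrBl.
have [c _ cmax] := @arg_maxP _ R (S i) a predT x isT.
have xc d : x d <= x c by exact: cmax.
suff : 0 <= dev X a c v.
  by rewrite !devx !subr_ge0; exact: le_trans.
case: (boolP (active p c)) => [|nactc]; first exact: act_dev.
pose z j := (j i == c)%:R * v (upd j a).
have z0 j : 0 <= z j by rewrite mulr_ge0.
(* Incentives that may vanish at [p] get the dummy value 1; they are treated separately below. *)
have [e e0 pert] : exists2 e, 0 < e & forall y : {i : 'I_n & (S i * S i)%type},
    0 <= (if ((tagged y).1 != (tagged y).2) && active p (tagged y).1
          then dev X (tagged y).1 (tagged y).2 p else 1)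
         + e * dev X (tagged y).1 (tagged y).2 z.
  apply: small_perturbation => y; case: ifP => // /andP[ne act].
  exact: strict.
pose q j := p j + e * z j.
have qc : in_cone X q.
  split=> [j|i' a' b']; first by rewrite addr_ge0 ?(compl_ge0 C)// mulr_ge0// ltW.
  rewrite /q /dev dotDr -/(dev X a' b' p) -/(dev X a' b' z).
  have [->|ne] := eqVneq a' b'; first by rewrite !dev_diag mulr0 addr0.
  have [_ pdev] := compl_cone C.
  have [E|ii'] := eqVneq i' i.
    subst i'; rewrite addr_ge0 ?pdev// mulr_ge0 ?(ltW e0)//.
    have [->|ac] := eqVneq a' c.
      rewrite devE (reindex_upd c a).
      suff -> : \sum_(j : profile S | j i == a) (X i (upd (upd j c) c) -
        X i (upd (upd j c) b')) * z (upd j c) = x c - x b' by rewrite subr_ge0.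
      rewrite /x -sumrB; apply: eq_bigr => j /eqP ja.
      by rewrite /z updE eqxx mul1r !updK -mulrBl -ja upd_id.
    rewrite devE big1// => j /eqP ja'; rewrite /z ja'.
    by rewrite (negbTE ac) mul0r mulr0.
  case: (boolP (active p a')) => [acta'|nacta'].
    by have := pert (existT _ i' (a', b')); rewrite /= ne acta'.
  suff -> : dev X a' b' z = 0 by rewrite mulr0 addr0 pdev.
  apply: big1 => j _; rewrite /coef; case: eqP => [ja'|]; last by rewrite !mul0r.
  rewrite /z (supp (upd j a)) ?mulr0//; apply/eqP; apply: contraNT nacta' => pj.
  by apply/existsP; exists (upd j a); rewrite updNE// ja' eqxx.
rewrite devE big1// => j /eqP ja.
suff -> : v j = 0 by rewrite mulr0.
have pj0 : p (upd j c) = 0.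
  apply/eqP; apply: contraNT nactc => pj; apply/existsP; exists (upd j c).
  by rewrite updE eqxx.
(* In the cone, [q] must vanish where [p] does, which kills the slice of [v] at [a]. *)
have := cone_supp C qc pj0; rewrite /q pj0 add0r /z updE eqxx mul1r updK -ja upd_id.
by move/eqP; rewrite mulf_eq0 gt_eqF//= => /eqP.
Qed.

End NeverBestResponse.

(** * Affine isomorphisms and interior points of polytopes *)

Section AffineGeometry.
Variable R : realType.

Lemma affine_isomorphism (V W : lmodType R) (P : set V) (Q : set W) (f : V -> W) :
  (forall m (x : 'I_m -> V) (c : 'I_m -> R), \sum_a c a = 1 ->
     f (\sum_a c a *: x a) = \sum_a c a *: f (x a)) ->
  (forall x y, affine_hull P x -> affine_hull P y -> f x = f y -> x = y) ->
  (f @` P = Q)%classic -> affinely_isomorphic P Q.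
Proof.
move=> faff finj fPQ; exists f; split=> //.
  move=> x y t _ _.
  have := faff 2 (fun a => if a == 0 then x else y) (fun a => if a == 0 then 1 - t else t).
  by rewrite !big_ord_recl !big_ord0 /= !addr0 => ->//; rewrite subrK.
split.
- move=> _ [m [x [c [Px c1 ->]]]]; exists m, (f \o x), c; split=> //.
    by move=> a; rewrite -fPQ; exists (x a).
  exact: faff.
- by move=> x y; rewrite !inE; exact: finj.
- move=> _ [m [y [c [Qy c1 ->]]]].
  have /boolp.choice[x xP] : forall a, exists x, P x /\ f x = y a.
    by move=> a; have := Qy a; rewrite -fPQ => -[x Px <-]; exists x.
  exists (\sum_a c a *: x a).
    by exists m, x, c; split=> // a; have [] := xP a.
  rewrite faff//; apply: eq_bigr => a _.
  by have [_ ->] := xP a.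
Qed.

Lemma CE_polytopeP (G : game R) (x : tensor G) :
  CE_polytope G x <-> in_cone (payoff G) x /\ \sum_j (x j : R) = 1.
Proof.
split=> [[x0 x1 xH]|[[x0 xH] x1]]; split=> //.
  by split=> // i a b; rewrite -Hform_dev.
by move=> i a b; rewrite Hform_dev.
Qed.

(** After normalization [p] is interior in the hyperplane of total mass one, so this hyperplane is
    the affine hull. *)
Lemma full_dimensional_interior (G : game R) (p : profile (strategy G) -> R) :
  profile (strategy G) -> (forall j, 0 < p j) ->
  (forall i (a b : strategy G i), a != b -> 0 < dev (payoff G) a b p) ->
  full_dimensional G.
Proof.
move=> j0 p_gt0 p_dev; set s := \sum_j p j.
have s0 : 0 < s.
  rewrite /s (bigD1 j0)//= ltr_wpDr//; apply: sumr_ge0 => j _; exact: ltW.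
pose total (x : tensor G) : R^o := \sum_j (x j : R).
have total_linear : linear total.
  move=> c x y; rewrite /total scaler_sumr -big_split; apply: eq_bigr => j _.
  by rewrite !ffunE.
pose tot : {linear tensor G -> R^o} :=
  HB.pack total (GRing.isLinear.Build _ _ _ _ total total_linear).
have totB u w : total (u - w) = total u - total w := linearB tot u w.
have totD u w : total (u + w) = total u + total w := linearD tot u w.
have totZ c u : total (c *: u) = c * total u := linearZ_LR tot c u.
have totS m (F : 'I_m -> tensor G) : total (\sum_a F a) = \sum_a total (F a) :=
  linear_sum tot _ _ _.
pose x0 : tensor G := [ffun j => p j / s].
have tot1 : total x0 = 1.
  by rewrite /total; under eq_bigr do rewrite ffunE; rewrite -mulr_suml divff ?gt_eqF.
have dev0 i (a b : strategy G i) :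
    dev (payoff G) a b (x0 : _ -> R) = dev (payoff G) a b p / s :> R.
  by rewrite /dev /dot mulr_suml; apply: eq_bigr => j _; rewrite ffunE mulrA.
exists x0, (lker (linfun tot)); split; last first.
  have := limg_ker_dim (linfun tot) fullv; rewrite capfv dimvf.
  have -> : \dim (limg (linfun tot)) = 1.
    apply/eqP; rewrite eqn_leq; apply/andP; split.
      by have := dimvS (subvf (limg (linfun tot))); rewrite dimvf /dim /=.
    rewrite lt0n dimv_eq0; apply/eqP => E.
    have := memv_img (linfun tot) (memvf x0); rewrite E memv0 lfunE /= tot1.
    by rewrite oner_eq0.
  rewrite addn1 => E.
  have {E} : (\dim (lker (linfun tot))).+1 = (#|profile (strategy G)| * 1)%N := E.
  by rewrite muln1 => <-.
have memU x : (x - x0 \in lker (linfun tot)) = (total x == 1).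
  by rewrite memv_ker lfunE /= totB tot1 subr_eq0.
apply/seteqP; split=> x /=; rewrite memU.
  move=> [m [y [c [Py c1 ->]]]]; apply/eqP.
  rewrite totS -[RHS]c1; apply: eq_bigr => a _ /=.
  by rewrite totZ; have /CE_polytopeP[_ E] := Py a; rewrite [total _]E mulr1.
move=> /eqP tx; pose d j : R := x j - x0 j.
pose I := ({i : 'I_(players G) & (strategy G i * strategy G i)%type} +
           profile (strategy G))%type.
have [e e0 pert] : exists2 e, 0 < e & forall r : I,
    0 <= match r with inl y => if (tagged y).1 != (tagged y).2
          then dev (payoff G) (tagged y).1 (tagged y).2 (x0 : _ -> R) else 1
                  | inr j => x0 j end
       + e * match r with inl y => dev (payoff G) (tagged y).1 (tagged y).2 d
             | inr j => d j end.
  apply: small_perturbation => -[y|j]; last by rewrite ffunE divr_gt0.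
  by case: ifP => // ne; rewrite dev0 divr_gt0// p_dev.
(* Then [x] is the combination of [x0] and [y] with weights [1 - e^-1] and [e^-1]. *)
pose y : tensor G := x0 + e *: (x - x0).
have yE j : y j = x0 j + e * d j :> R by rewrite /d !ffunE.
have x0c : in_cone (payoff G) (x0 : _ -> R).
  split=> [j|i a b]; first by rewrite ffunE divr_ge0 ?ltW.
  have [->|ne] := eqVneq a b; first by rewrite dev_diag.
  by rewrite dev0 divr_ge0 ?ltW// p_dev.
have Py : CE_polytope G y.
  apply/CE_polytopeP; split.
    split=> [j|i a b]; first by rewrite yE; exact: (pert (inr j)).
    have -> : dev (payoff G) a b (y : _ -> R) =
        dev (payoff G) a b (x0 : _ -> R) + e * dev (payoff G) a b d.
      by rewrite -dotDr; apply: eq_bigr => j _; rewrite yE.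
    have [->|ne] := eqVneq a b; first by rewrite !dev_diag mulr0 addr0.
    by have := pert (inl (existT _ i (a, b))); rewrite /= ne.
  rewrite -[LHS]/(total y) totD totZ totB tot1.
  by rewrite tx subrr mulr0 addr0.
exists 2, (fun a => if a == 0 then x0 else y), (fun a => if a == 0 then 1 - e^-1 else e^-1).
split.
- by move=> a; case: ifP => // _; apply/CE_polytopeP.
- by rewrite !big_ord_recl big_ord0 /= addr0 subrK.
rewrite !big_ord_recl big_ord0 /= addr0 /y scalerDr scalerA mulVf ?gt_eqF// scale1r.
by rewrite addrA -scalerDl subrK scale1r addrC subrK.
Qed.

End AffineGeometry.

(** * Subgames *)

Section Subgames.
Variables (R : realType) (G : game R).
Variable T : forall i : 'I_(players G), {set strategy G i}.
Hypothesis T0 : forall i, T i != finset.set0.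

Let sub := subgame G T T0.

Lemma sub_profile_in (j : profile (sub_strategy T)) i : sub_profile j i \in T i.
Proof. by rewrite ffunE; exact: valP. Qed.

Lemma sub_profile_inj : injective (@sub_profile R G T).
Proof.
move=> j j' /ffunP jj'; apply/ffunP => i; apply: val_inj.
by have := jj' i; rewrite !ffunE.
Qed.

Lemma sub_profile_onto (j : profile (strategy G)) :
  (forall i, j i \in T i) -> exists j' : profile (sub_strategy T), sub_profile j' = j.
Proof.
move=> jT; exists [ffun i => exist (fun s => s \in T i) (j i) (jT i)].
by apply/ffunP => i; rewrite !ffunE.
Qed.

Lemma sub_profile_upd (j : profile (sub_strategy T)) i (a : sub_strategy T i) :
  sub_profile (upd j a) = upd (sub_profile j) (val a).
Proof.
apply: profileP => i'; rewrite ffunE; have [->|ne] := eqVneq i' i.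
  by rewrite !updE.
by rewrite !updNE// ffunE.
Qed.

Lemma sum_sub_profile (F : profile (strategy G) -> R) :
  (forall j : profile (strategy G), (exists i, j i \notin T i) -> F j = 0) ->
  \sum_j F j = \sum_(j : profile (sub_strategy T)) F (sub_profile j).
Proof.
move=> F0.
transitivity (\sum_(j in codom (@sub_profile R G T)) F j).
  rewrite [RHS]big_mkcond; apply: eq_bigr => j _.
  case: ifPn => // jN; apply: F0; apply/existsP; rewrite -negb_forall.
  apply: contra jN => /forallP/sub_profile_onto[j' <-]; exact: codom_f.
rewrite -big_uniq; last by rewrite map_inj_uniq ?enum_uniq//; exact: sub_profile_inj.
by rewrite big_image.
Qed.

Lemma dev_subgame i (a b : sub_strategy T i) (q : profile (strategy G) -> R) :
  (forall j : profile (strategy G), (exists i, j i \notin T i) -> q j = 0) ->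
  dev (payoff sub) a b (fun j => q (@sub_profile R G T j)) =
  dev (payoff G) (val a) (val b) q.
Proof.
move=> q0; rewrite /dev /dot [RHS]sum_sub_profile.
  apply: eq_bigr => j _; congr (_ * _).
  by rewrite /coef /sub /= sub_profile_upd ffunE.
by move=> j /q0 ->; rewrite mulr0.
Qed.

Definition restrict (x : tensor G) : tensor sub := [ffun j => x (@sub_profile R G T j)].

Lemma restrict_comb m (x : 'I_m -> tensor G) (c : 'I_m -> R) :
  restrict (\sum_a c a *: x a) = \sum_a c a *: restrict (x a).
Proof.
apply/ffunP => j; rewrite ffunE !sum_ffunE; apply: eq_bigr => a _.
by rewrite !ffunE.
Qed.

End Subgames.

Definition reduces_to_full_subgame (R : realType) (G : game R) : Prop :=
  exists (T : forall i : 'I_(players G), {set strategy G i})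
         (T_neq0 : forall i, T i != finset.set0),
    [/\ proper_subgame G T,
        full_dimensional (subgame G T T_neq0)
      & affinely_isomorphic (CE_polytope G)
                            (CE_polytope (subgame G T T_neq0))].

(** * The rigid case and the strict case *)

Section Main.
Variables (R : realType) (G : game R).
Hypothesis G_generic : generic G.
Let S := strategy G.
Let X := payoff G.
Variables (k : rates S R) (mu p : profile S -> R).
Arguments k : clear implicits.
Hypothesis C : complementary X k mu p.

(** By [rigid] the polytope is one point, as is that of the subgame with the single profile [j0],
    which is proper because [a0] and [b0] differ. *)
Lemma rigid_subgame (j0 : profile S) i0 (a0 b0 : S i0) :
  p j0 != 0 -> a0 != b0 -> active p a0 -> 0 < k i0 a0 b0 ->
  reduces_to_full_subgame G.
Proof.
move=> pj0 ab acta kab.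
pose T i : {set S i} := [set j0 i]%SET.
have T0 i : T i != finset.set0 by apply/set0Pn; exists (j0 i); rewrite inE.
have valT i (a : sub_strategy T i) : val a = j0 i.
  by have := valP a; rewrite inE => /eqP.
have subT i (a b : sub_strategy T i) : a = b by apply: val_inj; rewrite !valT.
have profT (j j' : profile (sub_strategy T)) : j = j' by apply: profileP => i; exact: subT.
pose jT : profile (sub_strategy T) :=
  [ffun i => exist (fun s => s \in T i) (j0 i) (finset.set11 (j0 i))].
exists T, T0; split.
- exists i0; apply/eqP => /setP E.
  have := E a0; have := E b0; rewrite !inE => /eqP b0E /eqP a0E.
  by rewrite a0E b0E eqxx in ab.
- apply: (full_dimensional_interior (p := fun=> 1)).
  + exact: jT.
  + by move=> j; exact: ltr01.
  + by move=> i a b; rewrite (subT _ a b) eqxx.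
set Q := CE_polytope (subgame G T T0); pose y : tensor (subgame G T T0) := [ffun=> 1].
have Qy : Q y.
  apply/CE_polytopeP; split; last first.
    rewrite (bigD1 jT)//= ffunE big1 ?addr0// => j.
    by rewrite (profT j jT) eqxx.
  split=> [j|i a b]; first by rewrite ffunE ler01.
  by rewrite (subT _ a b) dev_diag.
have Q1 z : Q z -> z = y.
  move=> /CE_polytopeP[_ z1]; apply/ffunP => j; rewrite ffunE -z1.
  rewrite (bigD1 j)//= big1 ?addr0// => j'.
  by rewrite (profT j' j) eqxx.
pose s := \sum_j p j.
have s0 : s != 0.
  rewrite /s psumr_neq0 => [|? _]; last exact: compl_ge0 C _.
  by apply/hasP; exists j0; rewrite ?mem_index_enum// lt0r pj0 (compl_ge0 C).
pose x : tensor G := [ffun j => p j / s].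
have Px : CE_polytope G x.
  apply/CE_polytopeP; split; last first.
    by under eq_bigr do rewrite ffunE; rewrite -mulr_suml divff.
  have [p0 pdev] := compl_cone C.
  have sV : 0 <= s^-1 by rewrite invr_ge0; apply: sumr_ge0 => j _; exact: p0.
  split=> [j|i a b]; first by rewrite ffunE mulr_ge0.
  have -> : dev (payoff G) a b (x : _ -> R) = dev X a b p / s.
    by rewrite /dev /dot mulr_suml; apply: eq_bigr => j _; rewrite ffunE mulrA.
  by rewrite mulr_ge0.
have P1 z : CE_polytope G z -> z = x.
  move=> /CE_polytopeP[zc z1].
  have [c zE] := rigid C G_generic ab acta kab (cone_harmonious C G_generic zc).
  have cs : c * s = 1.
    by rewrite -z1 /s mulr_sumr; apply: eq_bigr => j _; rewrite zE.
  apply/ffunP => j; rewrite ffunE zE mulrC; congr (_ * _).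
  by rewrite -[LHS](mulfK s0) cs mul1r.
have hull z : affine_hull (CE_polytope G) z -> z = x.
  move=> [m [w [c [Pw c1 ->]]]].
  under eq_bigr do rewrite (P1 _ (Pw _)).
  by rewrite -scaler_suml c1 scale1r.
apply: (affine_isomorphism (f := fun=> y)).
- by move=> m w c c1; rewrite -scaler_suml c1 scale1r.
- by move=> z w /hull -> /hull ->.
- apply/seteqP; split=> [_ [z _ <-] //|z /Q1 ->].
  by exists x.
Qed.

(** By complementarity [p] is interior for the subgame of active strategies, and restriction to it
    inverts extension by zero. *)
Lemma strict_subgame (j0 : profile S) : ~ full_dimensional G ->
  p j0 != 0 -> (forall i (a b : S i), a != b -> active p a -> k i a b = 0) ->
  reduces_to_full_subgame G.
Proof.
move=> G_not_full pj0 k0.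
have strict i (a b : S i) : a != b -> active p a -> 0 < dev X a b p.
  by move=> ab acta; have := compl_dev C a b; rewrite k0// add0r.
pose T i : {set S i} := [set a | active p a]%SET.
have actj0 := proj2 (active_supp C G_generic j0) pj0.
have T0 i : T i != finset.set0 by apply/set0Pn; exists (j0 i); rewrite inE.
have suppT (j : profile S) : (exists i, j i \notin T i) -> p j = 0.
  move=> [i]; rewrite inE => nact; apply/eqP; apply: contraNT nact => pj.
  exact: (proj2 (active_supp C G_generic j) pj).
have inT (j : profile (sub_strategy T)) : 0 < p (sub_profile j).
  rewrite lt0r (compl_ge0 C) andbT; apply/(active_supp C G_generic) => i.
  by have := sub_profile_in j i; rewrite inE.
have [jT jTE] : exists j : profile (sub_strategy T), sub_profile j = j0.
  by apply: sub_profile_onto => i; rewrite inE.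
exists T, T0; split.
(* If every strategy were active, [p] would be interior for [G] itself. *)
- apply: contrapT => notproper; apply: G_not_full.
  have TT i (a : S i) : active p a.
    have [E|ne] := eqVneq (T i) [set: S i]%SET; last by case: notproper; exists i.
    by have := finset.in_setT a; rewrite -E inE.
  apply: (full_dimensional_interior (p := p)); first exact: j0.
    move=> j; rewrite lt0r (compl_ge0 C) andbT; apply/(active_supp C G_generic) => i.
    exact: TT.
  by move=> i a b ab; exact: strict.
- apply: (full_dimensional_interior (G := subgame G T T0)
    (p := fun j => p (@sub_profile R G T j))).
  + exact: jT.
  + exact: inT.
  + move=> i a b ab; rewrite dev_subgame//; apply: strict => //.
    by have := valP a; rewrite inE.
have coneT z : CE_polytope G z -> forall j, p j = 0 -> z j = 0.
  by move=> /CE_polytopeP[zc _] j pj; exact: (cone_supp C zc pj).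
apply: (affine_isomorphism (f := @restrict _ G T T0)).
- by move=> m w c _; exact: restrict_comb.
- have hullT z : affine_hull (CE_polytope G) z -> forall j, p j = 0 -> z j = 0.
    move=> [m [w [c [Pw _ ->]]]] j pj; rewrite sum_ffunE big1// => a _.
    by rewrite ffunE (coneT _ (Pw a))// scaler0.
  move=> x y hx hy /ffunP xy; apply/ffunP => j.
  have [pj|pj] := eqVneq (p j) 0; first by rewrite !hullT.
  have [j' <-] : exists j' : profile (sub_strategy T), sub_profile j' = j.
    apply: sub_profile_onto => i; rewrite inE.
    exact: (proj2 (active_supp C G_generic j) pj).
  by have := xy j'; rewrite !ffunE.
apply/seteqP; split=> [_ [z Pz <-]|q /CE_polytopeP[[q0 qdev] q1]].
  have zT (j : profile S) : (exists i, j i \notin T i) -> z j = 0 by move/suppT; exact: coneT.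
  move: (Pz) => /CE_polytopeP[[z0 zdev] z1]; apply/CE_polytopeP; split; last first.
    by rewrite -z1 (sum_sub_profile zT); apply: eq_bigr => j _; rewrite ffunE.
  split=> [j|i a b]; first by rewrite ffunE.
  have -> : (restrict T0 z : _ -> R) = fun j => z (@sub_profile R G T j).
    by apply/funext => j; rewrite ffunE.
  by rewrite (dev_subgame T0 a b zT).
(* Extension of [q] by zero, written as a sum over at most one preimage. *)
pose x : tensor G :=
  [ffun j => \sum_(j' : profile (sub_strategy T) | sub_profile j' == j) q j'].
have xE j : x (sub_profile j) = q j.
  rewrite ffunE (bigD1 j)//= big1 ?addr0// => j' /andP[/eqP/sub_profile_inj ->].
  by rewrite eqxx.
have xT (j : profile S) : (exists i, j i \notin T i) -> x j = 0.
  move=> [i jN]; rewrite ffunE big1// => j' /eqP E.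
  by move: jN; rewrite -E sub_profile_in.
have x0 j : 0 <= (x j : R) by rewrite ffunE; apply: sumr_ge0 => j' _; exact: q0.
exists x; last by apply/ffunP => j; rewrite ffunE xE.
apply/CE_polytopeP; split; last first.
  by rewrite (sum_sub_profile xT) -q1; apply: eq_bigr => j _; rewrite xE.
apply: (restricted_cone C strict) => //.
  move=> j pj; apply: xT; apply/existsP; rewrite -negb_forall.
  apply/negP => /forallP act; have := proj1 (active_supp C G_generic j).
  rewrite pj eqxx => /(_ _); suff : forall i, active p (j i) by move=> h /(_ h).
  by move=> i; have := act i; rewrite inE.
move=> i a b acta actb.
have aT : a \in T i by rewrite inE.
have bT : b \in T i by rewrite inE.
have := qdev i (exist _ a aT) (exist _ b bT).
have -> : (q : _ -> R) = fun j => x (@sub_profile R G T j).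
  by apply/funext => j; rewrite xE.
by rewrite (dev_subgame T0 _ _ xT).
Qed.

End Main.

Theorem theorem1p1 (R : realType) (G : game R) (G_generic : generic G)
    (G_not_full : ~ full_dimensional G) :
  exists (T : forall i : 'I_(players G), {set strategy G i})
         (T_neq0 : forall i, T i != finset.set0),
    [/\ proper_subgame G T,
        full_dimensional (subgame G T T_neq0)
      & affinely_isomorphic (CE_polytope G)
                            (CE_polytope (subgame G T T_neq0))].
Proof.
have [k [mu [p C]]] := complementary_exists (payoff G).
have [j0 pj0] := compl_neq0 C (fun i => enum_val (Ordinal (strategy_gt0 i))).
(* Either an edge leads from an active strategy to a different one, or complementarity makes all
   incentives out of active strategies strict. *)
have [[i [a [b [ab acta kab]]]]|noedge] := pselect (exists i (a b : strategy G i),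
    [/\ a != b, active p a & 0 < k i a b]).
  exact: (rigid_subgame G_generic C pj0 ab acta kab).
apply: (strict_subgame G_generic C G_not_full pj0) => i a b ab acta.
apply: le_anti; rewrite (compl_rates_ge0 C) andbT leNgt.
by apply/negP => kab; apply: noedge; exists i, a, b.
Qed.
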